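(* There exist universal constants $c_1, C, C'>0$ such that the following holds. Let $\bm{M}^\star=\lambda^\star\bm{u}^\star\bm{u}^{\star\top}\in\mathbb{R}^{n\times n}$ be a rank-1 symmetric matrix ($\lambda^\star\neq 0$, $\|\bm{u}^\star\|_2=1$) with incoherence parameter $\mu$, and let $\bm{M}=\bm{M}^\star+\bm{H}$, where the random noise matrix $\bm{H}$ satisfies the noise assumption with parameters $\sigma,B$ (see context). Suppose $$\max\{\sigma\sqrt{n\log n},\,B\log n\}\le c_1|\lambda^\star|.$$ Let $\bm{u}$ be the leading eigenvector of $\bm{M}$. Then with probability at least $1-C'n^{-9}$, $$\min\big\{\|\bm{u}-\bm{u}^\star\|_\infty,\,\|\bm{u}+\bm{u}^\star\|_\infty\big\}\le C\,\frac{\max\{\sigma\sqrt{n\log n},\,B\log n\}}{|\lambda^\star|}\sqrt{\frac{\mu}{n}}.$$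
   Context: Noise assumption with parameters $\sigma=\sigma_n\ge 0$, $B=B_n>0$ on a random matrix $\bm{H}=[H_{ij}]\in\mathbb{R}^{n\times n}$: (1) the entries $H_{ij}$, $1\le i,j\le n$, are independent (no symmetry is imposed, and they need not be identically distributed); (2) $\mathbb{E}[H_{ij}]=0$; (3) $\mathrm{Var}(H_{ij})\le\sigma^2$; (4) each $H_{ij}$ satisfies either (a) $|H_{ij}|\le B$, or (b) $H_{ij}$ has a symmetric distribution with $\mathbb{P}\{|H_{ij}|>B\}\le c_{\mathrm b}n^{-12}$, where $c_{\mathrm b}>0$ is a fixed universal constant. Incoherence parameter of $\bm{M}^\star=\lambda^\star\bm{u}^\star\bm{u}^{\star\top}$: the smallest $\mu$ with $\|\bm{u}^\star\|_\infty\le\sqrt{\mu/n}$. The leading eigenvector $\bm{u}$ of the (generally asymmetric) matrix $\bm{M}$ is a (right) eigenvector with $\|\bm{u}\|_2=1$ associated with the eigenvalue of $\bm{M}$ of largest modulus, taken real whenever that eigenvalue is real. *)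

(* Defs.v *)
(* MathComp / MathComp-Analysis *)
From HB Require Import structures.
From mathcomp Require Export all_boot all_order all_algebra.
From mathcomp Require Export complex.
From mathcomp Require Export all_classical all_reals all_analysis.
Set Implicit Arguments.
Unset Strict Implicit.
Unset Printing Implicit Defensive.
Import Order.TTheory GRing.Theory Num.Theory.
Import numFieldNormedType.Exports.
Local Open Scope classical_set_scope.
Local Open Scope ring_scope.
Local Open Scope complex_scope.

(* The leading eigenvector of a real asymmetric matrix may be complex: real
   vectors and matrices are compared with complex ones through this embedding. *)
Definition toC (R : realType) (m n : nat) (A : 'M[R]_(m, n)) : 'M[R[i]]_(m, n) :=
  map_mx (real_complex R) A.

(* [normc z : R] is the modulus of z; the modulus [`|z|] of a complex number
   has type R[i]. *)
Definition norm2 (R : realType) (n : nat) (v : 'cV[R[i]]_n) : R :=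
  Num.sqrt (\sum_(k < n) ComplexField.Normc.normc (v k 0) ^+ 2).

Definition norm_inf (R : realType) (n : nat) (v : 'cV[R[i]]_n) : R :=
  \big[Num.max/0]_(k < n) ComplexField.Normc.normc (v k 0).

Definition is_incoherence (R : realType) (n : nat) (u : 'cV[R]_n) (mu : R) : Prop :=
  [/\ 0 <= mu,
      norm_inf (toC u) <= Num.sqrt (mu / n%:R)
    & forall nu : R, 0 <= nu ->
        norm_inf (toC u) <= Num.sqrt (nu / n%:R) -> mu <= nu].

(* [eigenvalue] is defined through row vectors, but a square matrix has the
   same left and right eigenvalues. *)
Definition is_leading_eigenvalue (R : realType) (n : nat) (M : 'M[R]_n)
    (l : R[i]) : Prop :=
  eigenvalue (toC M) l /\ forall z : R[i], eigenvalue (toC M) z -> `|z| <= `|l|.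

Definition is_leading_eigenvector (R : realType) (n : nat) (M : 'M[R]_n)
    (u : 'cV[R[i]]_n) : Prop :=
  exists l : R[i],
    [/\ is_leading_eigenvalue M l,
        toC M *m u = l *: u,
        norm2 u = 1
      & l \is Num.real -> u \is a mxOver Num.real].

Definition mutually_independent (d : measure_display) (T : measurableType d)
    (R : realType) (P : probability T R) (I : finType) (X : I -> {RV P >-> R}) : Prop :=
  forall (J : {set I}) (A : I -> set R), (forall k, measurable (A k)) ->
    P (\bigcap_(k in [set` J]) (X k @^-1` A k)) =
    (\prod_(k in J) P (X k @^-1` A k))%E.

Definition symmetric_distribution (d : measure_display) (T : measurableType d)
    (R : realType) (P : probability T R) (X : {RV P >-> R}) : Prop :=
  forall A : set R, measurable A -> P [set w | A (- X w)] = P [set w | A (X w)].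

(* ['E_P[X] = 0] forces X to be integrable, since the integral of a
   non-integrable function is infinite. *)
Definition noise_assumption (d : measure_display) (T : measurableType d)
    (R : realType) (P : probability T R) (n : nat) (cb sigma B : R)
    (H : 'I_n -> 'I_n -> {RV P >-> R}) : Prop :=
  [/\ mutually_independent (fun ij : 'I_n * 'I_n => H ij.1 ij.2),
      forall i j, ('E_P[H i j] = 0)%E,
      forall i j, (variance P (H i j) <= (sigma ^+ 2)%:E)%E
    & forall i j,
        {ae P, forall w, `|H i j w| <= B} \/
        (symmetric_distribution (H i j) /\
         (P [set w | (B < `|H i j w|)%R] <= (cb * n%:R ^- 12)%:E)%E)].

Definition random_matrix (d : measure_display) (T : measurableType d)
    (R : realType) (P : probability T R) (n : nat)
    (H : 'I_n -> 'I_n -> {RV P >-> R}) (w : T) : 'M[R]_n :=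
  \matrix_(i, j) H i j w.

(* A need not be measurable: only a measurable subset has to have probability
   at least p. *)
Definition holds_with_probability_at_least (d : measure_display)
    (T : measurableType d) (R : realType) (P : probability T R) (p : R)
    (A : set T) : Prop :=
  exists E : set T, [/\ measurable E, E `<=` A & (p%:E <= P E)%E].

Definition noise_level (R : realType) (n : nat) (sigma B : R) : R :=
  Num.max (sigma * Num.sqrt (n%:R * ln n%:R)) (B * ln n%:R).

(* Main.v *)
(* Truncate the noise at level B, which changes nothing outside an event of
   probability O(n^-10), and expand powers of an entry of H^s v as sums over
   walks. An expected product of entries vanishes unless every edge of the walk
   is used at least twice, so at most half of the steps are new edges; with
   N = O(log n) steps, charging 1/n to a new edge and 1/N to a repeated one gives
   E |e_i^T H^s v|^(2m) <= (2 nu)^(2ms) |v|_inf^(2m) with nu of the order of the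
   noise level. Markov's inequality with 2ms of order log n yields, with high
   probability, |H^s us|_inf <= (C nu)^s |us|_inf for all s up to log2 n and, from
   the entries of (H^T H)^(log2 n), |H|_2 <= C nu.

   On that event, M has exactly one eigenvalue l of modulus at least |lambda|/2
   and it is real, so the leading eigenvector is real and satisfies
   u = (lambda/l) (us^T u) sum_s (H/l)^s us. The coefficient of the s = 0 term
   is 1 + O(nu / lambda) up to sign, the terms 0 < s <= log2 n are bounded
   entrywise, and the remainder is at most (2 C nu / lambda)^(log2 n), which is
   below |us|_inf >= n^(-1/2). *)
Require Import Defs.
From mathcomp Require Import measurable_realfun zify ring lra.
Set Implicit Arguments.
Unset Strict Implicit.
Unset Printing Implicit Defensive.
Import Order.TTheory GRing.Theory Num.Theory.
Import numFieldNormedType.Exports.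
Local Open Scope classical_set_scope.
Local Open Scope ring_scope.
Local Open Scope complex_scope.

(** * Sums over walks *)

(** [h] lists the edges already traversed, and [P] is a budget for the number of traversals, not a
    probability. *)
Definition step_weight (R : realType) (E : eqType) (n P : nat) (h : seq E)
    (e : E) : R :=
  if e \in h then P%:R^-1 else n%:R^-1.

Fixpoint seq_weight (R : realType) (E : eqType) (n P : nat) (h es : seq E) : R :=
  if es is e :: es' then step_weight R n P h e * seq_weight R n P (e :: h) es'
  else 1.

Lemma step_weight_ge0 (R : realType) (E : eqType) (n P : nat) (h : seq E) (e : E) :
  0 <= step_weight R n P h e.
Proof. by rewrite /step_weight; case: ifP => _; rewrite invr_ge0 ler0n. Qed.

Lemma seq_weight_ge0 (R : realType) (E : eqType) (n P : nat) (h es : seq E) :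
  0 <= seq_weight R n P h es.
Proof.
by elim: es h => //= e es IH h; rewrite mulr_ge0 ?step_weight_ge0.
Qed.

Lemma seq_weight_cat (R : realType) (E : eqType) (n P : nat) (h s1 s2 : seq E) :
  seq_weight R n P h (s1 ++ s2) =
  seq_weight R n P h s1 * seq_weight R n P (catrev s1 h) s2.
Proof.
by elim: s1 h => [|e s1 IH] h /=; [rewrite mul1r | rewrite IH mulrA].
Qed.

Lemma prod_seq_count (R : realType) (E : finType) (x : E -> R) (es : seq E) :
  \prod_(e <- es) x e = \prod_(e : E) x e ^+ count_mem e es.
Proof.
elim: es => [|e es IH]; first by rewrite big_nil big1.
rewrite big_cons IH (bigD1 e) //= [RHS](bigD1 e) //= eqxx exprD expr1 -!mulrA.
by do 2?congr *%R; apply: eq_bigr => i /negPf; rewrite eq_sym => ->.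
Qed.

(** The share of a single edge in [seq_weight]: only its first traversal can be new, and only if the
    edge is absent from the history. *)
Definition edge_weight (R : realType) (n P : nat) (old : bool) (k : nat) : R :=
  if old then P%:R ^- k
  else if k is k'.+1 then n%:R^-1 * P%:R ^- k' else 1.

(** Whether a traversal is new depends only on the history and on earlier traversals of the same
    edge, so the weight regroups edge by edge. *)
Lemma seq_weight_prod (R : realType) (E : finType) (n P : nat) (h es : seq E) :
  seq_weight R n P h es =
  \prod_(e : E) edge_weight R n P (e \in h) (count_mem e es).
Proof.
elim: es h => [|e es IH] h.
  by rewrite big1 // => e _; rewrite /edge_weight; case: ifP; rewrite ?invr1.
rewrite /= IH (bigD1 e) //= [RHS](bigD1 e) //= mulrA !inE !eqxx /=; congr *%R.
  rewrite /step_weight /edge_weight; case: ifP => _ //.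
  by rewrite exprD expr1 invfM.
apply: eq_bigr => i /negPf ie.
by rewrite !inE ie eq_sym ie.
Qed.

(* Quantifying over the earlier steps h makes these bounds multiplicative: in a
   product of two sums, the edges of the first factor are old for the second. *)
Definition controlled (R : realType) (E : finType) (n P p : nat) (K : R)
    (Z : (E -> R) -> R) : Prop :=
  exists W : seq (R * seq E),
    [/\ forall x, Z x = \sum_(w <- W) w.1 * \prod_(e <- w.2) x e,
        forall w, w \in W -> size w.2 = p
      & forall h : seq E, (size h + p <= P)%N ->
          \sum_(w <- W) `|w.1| * seq_weight R n P h w.2 <= K].

Lemma controlled_cst (R : realType) (E : finType) (n P : nat) (K c : R) :
  `|c| <= K -> controlled (E := E) n P 0 K (fun _ => c).
Proof.
move=> cK; exists [:: (c, [::])]; split => [x|w|h _].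
- by rewrite big_seq1 big_nil mulr1.
- by rewrite inE => /eqP ->.
- by rewrite big_seq1 mulr1.
Qed.

Lemma controlled_ext (R : realType) (E : finType) (n P p : nat) (K : R)
    (Z Z' : (E -> R) -> R) :
  (forall x, Z x = Z' x) -> controlled n P p K Z -> controlled n P p K Z'.
Proof.
by move=> ZZ' [W [ZW sW bW]]; exists W; split => // x; rewrite -ZZ'.
Qed.

(** Reading a word of the first factor lengthens the history by [p], which still leaves budget [q];
    the bound [L] on the second factor therefore holds uniformly over the words of the first. *)
Lemma controlled_mul (R : realType) (E : finType) (n P p q : nat) (K L : R)
    (Y Z : (E -> R) -> R) : 0 <= K -> 0 <= L ->
  controlled n P p K Y -> controlled n P q L Z ->
  controlled n P (p + q) (K * L) (fun x => Y x * Z x).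
Proof.
move=> K0 L0 [V [YV sV bV]] [W [ZW sW bW]].
exists [seq (v.1 * w.1, v.2 ++ w.2) | v <- V, w <- W]; split => [x|u|h hP].
- rewrite YV ZW big_distrl big_allpairs_dep /=; apply: eq_bigr => v _.
  rewrite big_distrr; apply: eq_bigr => w _ /=.
  by rewrite big_cat /= mulrACA.
- case/allpairsP => -[v w] [/= vV wW ->] /=.
  by rewrite size_cat (sV _ vV) (sW _ wW).
- rewrite big_allpairs_dep /= big_seq.
  apply: (@le_trans _ _ (\sum_(v <- V | v \in V) `|v.1| * seq_weight R n P h v.2 * L)).
    apply: ler_sum => v vV.
    under eq_bigr => w _ do rewrite /= normrM seq_weight_cat mulrACA.
    rewrite -big_distrr /=; apply: ler_wpM2l.
      by rewrite mulr_ge0 ?seq_weight_ge0.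
    by apply: bW; rewrite catrevE size_cat size_rev (sV _ vV) [(p + _)%N]addnC -addnA.
  rewrite -big_seq -big_distrl /=; apply: ler_wpM2r => //; apply: bV.
  by apply: leq_trans hP; rewrite leq_add2l leq_addr.
Qed.

Lemma controlled_expr (R : realType) (E : finType) (n P p r : nat) (K : R)
    (Z : (E -> R) -> R) : 0 <= K ->
  controlled n P p K Z -> controlled n P (r * p) (K ^+ r) (fun x => Z x ^+ r).
Proof.
move=> K0 cZ; elim: r => [|r IH].
  by apply: controlled_cst; rewrite normr1.
apply: (@controlled_ext _ _ _ _ _ _ (fun x => Z x * Z x ^+ r)).
  by move=> x; rewrite exprS.
by rewrite mulSn exprS; apply: controlled_mul; rewrite ?exprn_ge0.
Qed.

(* A new edge costs 1/n for each of its n possible endpoints, and there are at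
   most P old edges, each costing 1/P: one step of a walk costs at most 2. *)
Lemma sum_step_weight_le2 (R : realType) (E : eqType) (n P : nat)
    (f : 'I_n -> E) (h : seq E) : injective f -> (size h <= P)%N ->
  \sum_(j < n) step_weight R n P h (f j) <= 2.
Proof.
move=> finj hP.
rewrite (bigID (fun j => f j \in h)) /=.
have -> : \sum_(j < n | f j \in h) step_weight R n P h (f j) =
    #|[set j | f j \in h]%SET|%:R / P%:R.
  rewrite (eq_bigr (fun _ => P%:R^-1)); last by move=> j jh; rewrite /step_weight jh.
  by rewrite sumr_const -cardsE mulr_natl.
have -> : \sum_(j < n | f j \notin h) step_weight R n P h (f j) =
    #|[set j | f j \notin h]%SET|%:R / n%:R.
  rewrite (eq_bigr (fun _ => n%:R^-1)); last first.
    by move=> j /negPf jh; rewrite /step_weight jh.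
  by rewrite sumr_const -cardsE mulr_natl.
have div_le1 (a b : nat) : (a <= b)%N -> a%:R / b%:R <= 1 :> R.
  case: b => [|b] ab; first by rewrite invr0 mulr0.
  by rewrite ler_pdivrMr ?ltr0n // mul1r ler_nat.
have -> : 2 = 1 + 1 :> R by [].
apply: lerD; apply: div_le1.
  apply: leq_trans hP; rewrite cardE -(size_map f); apply: uniq_leq_size.
    by rewrite map_inj_uniq ?enum_uniq.
  by move=> e /mapP [j]; rewrite mem_enum inE => jh ->.
by rewrite (leq_trans (max_card _)) ?card_ord.
Qed.

(** The weight of the first edge factors out, because [K] bounds the rest for every history,
    including the one which that edge has just joined. The first edges then contribute at most 2. *)
Lemma controlled_step (R : realType) (E : finType) (n P p : nat) (K : R)
    (f : 'I_n -> E) (Z : 'I_n -> (E -> R) -> R) : 0 <= K -> injective f ->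
  (forall j, controlled n P p K (Z j)) ->
  controlled n P p.+1 (2 * K) (fun x => \sum_(j < n) x (f j) * Z j x).
Proof.
move=> K0 finj /fin_all_exists [W HW].
exists (flatten [seq [seq (w.1, f j :: w.2) | w <- W j] | j <- enum 'I_n]).
split => [x|w|h hP].
- rewrite big_flatten big_map big_enum; apply: eq_bigr => j _ /=.
  have [-> _ _] := HW j.
  rewrite big_map big_distrr; apply: eq_bigr => w _ /=.
  by rewrite big_cons mulrCA.
- case/flattenP => s /mapP [j _ ->] /mapP [w' w'W ->] /=.
  by have [_ /(_ _ w'W) -> _] := HW j.
- rewrite big_flatten big_map big_enum /=.
  apply: (@le_trans _ _ (\sum_(j < n) step_weight R n P h (f j) * K)).
    apply: ler_sum => j _; rewrite big_map /=.
    under eq_bigr => w _ do rewrite mulrCA.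
    rewrite -big_distrr /=; apply: ler_wpM2l; first exact: step_weight_ge0.
    by have [_ _] := HW j; apply; rewrite /= addSnnS.
  rewrite -big_distrl /=; apply: ler_wpM2r => //.
  apply: sum_step_weight_le2 => //.
  by apply: leq_trans hP; rewrite leq_addr.
Qed.

Definition entries_mx (R : realType) (n : nat) (x : 'I_n * 'I_n -> R) : 'M[R]_n :=
  \matrix_(i, j) x (i, j).

Lemma controlled_walk (R : realType) (n P s : nat) (kappa : R) (v : 'cV[R]_n)
    (i : 'I_n) : (forall j, `|v j 0| <= kappa) ->
  controlled n P s (2 ^+ s * kappa)
    (fun x => iter s (mulmx (entries_mx x)) v i 0).
Proof.
move=> vk; have k0 : 0 <= kappa by apply: le_trans (vk i); rewrite normr_ge0.
elim: s i => [|s IH] i; first by rewrite mul1r; apply: (@controlled_cst _ _ _ _ _ (v i 0)).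
rewrite exprS -mulrA.
apply: (@controlled_ext _ _ _ _ _ _ (fun x : 'I_n * 'I_n -> R =>
   \sum_(j < n) x (i, j) * iter s (mulmx (entries_mx x)) v j 0)).
  by move=> x; rewrite [RHS]mxE; apply: eq_bigr => j _; rewrite mxE.
apply: controlled_step => //; first by rewrite mulr_ge0 ?exprn_ge0.
by move=> j k [].
Qed.

(** One Gram factor is two steps: the edge [(j, i)] comes from the transpose and [(j, k)] from the
    matrix. Both families are injective in their summation index, so each step costs a factor 2. *)
Lemma controlled_gram_walk (R : realType) (n P s : nat) (kappa : R) (v : 'cV[R]_n)
    (i : 'I_n) : (forall j, `|v j 0| <= kappa) ->
  controlled n P s.*2 (2 ^+ s.*2 * kappa)
    (fun x => iter s (fun w => (entries_mx x)^T *m (entries_mx x *m w)) v i 0).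
Proof.
move=> vk; have k0 : 0 <= kappa by apply: le_trans (vk i); rewrite normr_ge0.
elim: s i => [|s IH] i; first by rewrite mul1r; apply: (@controlled_cst _ _ _ _ _ (v i 0)).
rewrite doubleS !exprS -!mulrA.
apply: (@controlled_ext _ _ _ _ _ _ (fun x : 'I_n * 'I_n -> R =>
   \sum_(j < n) x (j, i) * \sum_(k < n) x (j, k) *
     iter s (fun w => (entries_mx x)^T *m (entries_mx x *m w)) v k 0)).
  move=> x; rewrite [RHS]mxE; apply: eq_bigr => j _; rewrite !mxE; congr *%R.
  by apply: eq_bigr => k _; rewrite mxE.
have p0 : 0 <= 2 ^+ s.*2 * kappa by rewrite mulr_ge0 ?exprn_ge0.
apply: (controlled_step (f := fun j => (j, i))); first by rewrite mulr_ge0.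
  by move=> j k [].
move=> j; apply: (controlled_step (f := fun k => (j, k))) => //.
by move=> k l [].
Qed.

(* An edge traversed k >= 2 times contributes at most sigma^2 B^(k-2), which is
   nu^k times the weight of one new and k - 1 old traversals; edges traversed
   once contribute nothing. *)
Lemma prod_moments_le (R : realType) (E : finType) (n P : nat) (sigma B nu : R)
    (m : E -> nat -> R) (es : seq E) : (0 < n)%N -> (0 < P)%N ->
  0 <= sigma -> 0 <= B ->
  sigma * Num.sqrt (n * P)%:R <= nu -> B * P%:R <= nu ->
  (forall e, m e 0%N = 1) -> (forall e, m e 1%N = 0) ->
  (forall e k, `|m e k.+2| <= sigma ^+ 2 * B ^+ k) ->
  `|\prod_(e : E) m e (count_mem e es)| <=
    nu ^+ size es * seq_weight R n P [::] es.
Proof.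
move=> n0 P0 s0 B0 snu Bnu m0 m1 m2.
have nu0 : 0 <= nu by apply: le_trans Bnu; rewrite mulr_ge0.
have -> : nu ^+ size es = \prod_(e : E) nu ^+ count_mem e es.
  rewrite -(prod_seq_count (fun=> nu)); elim: es => [|e es IH].
    by rewrite big_nil.
  by rewrite big_cons /= exprS IH.
rewrite normr_prod seq_weight_prod -big_split /=.
apply: ler_prod => e _; rewrite normr_ge0 /=.
case: (count_mem e es) => [|[|k]].
- by rewrite m0 normr1 mul1r.
- by rewrite m1 normr0 mulr_ge0 // invr1 mulr1 invr_ge0.
apply: (le_trans (m2 e k)).
have nR : 0 < n%:R :> R by rewrite ltr0n.
have PR : 0 < P%:R :> R by rewrite ltr0n.
(* The new traversal and one old traversal are split off from the other [k]: the bound on [sigma]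
   handles the first factor, the bound on [B] the second. *)
have -> : nu ^+ k.+2 * edge_weight R n P (e \in [::]) k.+2 =
   (nu ^+ 2 / (n * P)%:R) * (nu / P%:R) ^+ k.
  by rewrite /edge_weight /= !exprS exprMn natrM exprVn; field; rewrite expf_neq0 ?gt_eqF.
apply: ler_pM; rewrite ?exprn_ge0 //.
  rewrite ler_pdivlMr ?ltr0n ?muln_gt0 ?n0 //.
  rewrite -[(n * P)%:R]sqr_sqrtr ?ler0n // -exprMn.
  by rewrite lerXn2r ?nnegrE // mulr_ge0 ?sqrtr_ge0.
by rewrite lerXn2r ?nnegrE ?divr_ge0 ?ler_pdivlMr.
Qed.
(** * Perturbation of the leading eigenvector *)

(** The quadratic [quad] is a sum of squares; its value at the minimiser [S / A] gives the
    inequality, and [A = 0] forces every [a i] to vanish. *)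
Lemma cauchy_schwarz_sum (R : realType) (I : finType) (a b : I -> R) :
  \sum_i a i * b i <= Num.sqrt (\sum_i a i ^+ 2) * Num.sqrt (\sum_i b i ^+ 2).
Proof.
set A := \sum_i a i ^+ 2; set B := \sum_i b i ^+ 2; set S := \sum_i _.
have A0 : 0 <= A by apply: sumr_ge0 => i _; exact: sqr_ge0.
have quad t : 0 <= A * t ^+ 2 - 2 * S * t + B.
  suff -> : A * t ^+ 2 - 2 * S * t + B = \sum_i (a i * t - b i) ^+ 2.
    by apply: sumr_ge0 => i _; exact: sqr_ge0.
  rewrite mulr_suml mulr_sumr mulr_suml -sumrN -!big_split /=.
  by apply: eq_bigr => i _; ring.
rewrite -sqrtrM //; have [A_eq0|A_neq0] := eqVneq A 0.
  have -> : S = 0; last exact: sqrtr_ge0.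
  apply: big1 => i _; have /eqP := A_eq0; rewrite psumr_eq0; last first.
    by move=> j _; exact: sqr_ge0.
  by move/allP/(_ i (mem_index_enum _)); rewrite /= sqrf_eq0 => /eqP ->; rewrite mul0r.
have Agt0 : 0 < A by rewrite lt_def A_neq0.
apply: le_trans (ler_norm _) _; rewrite -sqrtr_sqr ler_wsqrtr //.
have := quad (S / A).
have -> : A * (S / A) ^+ 2 - 2 * S * (S / A) + B = (A * B - S ^+ 2) / A by field.
by rewrite pmulr_lge0 ?invr_gt0 // subr_ge0.
Qed.

Lemma minkowski_sum (R : realType) (I : finType) (a b : I -> R) :
  Num.sqrt (\sum_i (a i + b i) ^+ 2) <=
  Num.sqrt (\sum_i a i ^+ 2) + Num.sqrt (\sum_i b i ^+ 2).
Proof.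
have pos (c : I -> R) : 0 <= \sum_i c i ^+ 2.
  by apply: sumr_ge0 => i _; exact: sqr_ge0.
rewrite -ler_sqr ?nnegrE ?addr_ge0 ?sqrtr_ge0 // sqr_sqrtr //.
rewrite sqrrD !sqr_sqrtr //.
have -> : \sum_i (a i + b i) ^+ 2 =
    \sum_i a i ^+ 2 + (\sum_i a i * b i) *+ 2 + \sum_i b i ^+ 2.
  by rewrite -sumrMnl -!big_split /=; apply: eq_bigr => i _; ring.
by rewrite lerD2r lerD2l lerMn2r /= cauchy_schwarz_sum.
Qed.

Notation normc := ComplexField.Normc.normc.

Lemma normc_ge0 (R : realType) (z : R[i]) : 0 <= normc z.
Proof. by case: z => a b; exact: sqrtr_ge0. Qed.

Lemma normc_real (R : realType) (a : R) : normc a%:C = `|a|.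
Proof. by rewrite /normc /= expr0n addr0 sqrtr_sqr. Qed.

Lemma normc_sum_le (R : realType) (I : Type) (r : seq I) (F : I -> R[i]) :
  normc (\sum_(i <- r) F i) <= \sum_(i <- r) normc (F i).
Proof.
elim: r => [|i r IH]; first by rewrite !big_nil ComplexField.Normc.normc0.
by rewrite !big_cons (le_trans (le_normcD _ _)) // lerD2l.
Qed.

Lemma norm2_ge0 (R : realType) (n : nat) (v : 'cV[R[i]]_n) : 0 <= norm2 v.
Proof. exact: sqrtr_ge0. Qed.

Lemma norm2_sqr (R : realType) (n : nat) (v : 'cV[R[i]]_n) :
  norm2 v ^+ 2 = \sum_(k < n) normc (v k 0) ^+ 2.
Proof. by rewrite sqr_sqrtr //; apply: sumr_ge0 => k _; exact: sqr_ge0. Qed.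

Lemma norm2D (R : realType) (n : nat) (v w : 'cV[R[i]]_n) :
  norm2 (v + w) <= norm2 v + norm2 w.
Proof.
apply: le_trans (minkowski_sum _ _).
apply: ler_wsqrtr; apply: ler_sum => k _; rewrite mxE.
by rewrite lerXn2r ?nnegrE ?addr_ge0 ?normc_ge0 ?le_normcD.
Qed.

Lemma norm2Z (R : realType) (n : nat) (a : R[i]) (v : 'cV[R[i]]_n) :
  norm2 (a *: v) = normc a * norm2 v.
Proof.
rewrite /norm2 -[normc a]ger0_norm ?normc_ge0 // -sqrtr_sqr -sqrtrM ?sqr_ge0 //.
congr Num.sqrt; rewrite mulr_sumr; apply: eq_bigr => k _.
by rewrite mxE ComplexField.Normc.normcM exprMn.
Qed.

Lemma norm2N (R : realType) (n : nat) (v : 'cV[R[i]]_n) : norm2 (- v) = norm2 v.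
Proof. by rewrite /norm2; under eq_bigr do rewrite mxE normcN. Qed.

Lemma normc_le_norm2 (R : realType) (n : nat) (v : 'cV[R[i]]_n) (k : 'I_n) :
  normc (v k 0) <= norm2 v.
Proof.
rewrite -[leLHS]ger0_norm ?normc_ge0 // -sqrtr_sqr; apply: ler_wsqrtr.
by rewrite (bigD1 k) //= lerDl; apply: sumr_ge0 => j _; exact: sqr_ge0.
Qed.

Lemma norm2_eq0 (R : realType) (n : nat) (v : 'cV[R[i]]_n) : norm2 v <= 0 -> v = 0.
Proof.
move=> v0; apply/matrixP => k j; rewrite ord1 mxE.
apply: ComplexField.Normc.eq0_normc; apply/eqP; rewrite eq_le normc_ge0 andbT.
exact: le_trans (normc_le_norm2 v k) v0.
Qed.

Lemma normc_dot_le (R : realType) (n : nat) (v w : 'cV[R[i]]_n) :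
  normc ((v^T *m w) 0 0) <= norm2 v * norm2 w.
Proof.
rewrite mxE (le_trans (normc_sum_le _ _)) //.
apply: le_trans (cauchy_schwarz_sum _ _).
by apply: ler_sum => k _; rewrite ComplexField.Normc.normcM mxE.
Qed.

Lemma norm2_real_sqr (R : realType) (n : nat) (v : 'cV[R]_n) :
  norm2 (toC v) ^+ 2 = \sum_(k < n) v k 0 ^+ 2.
Proof.
by rewrite norm2_sqr; apply: eq_bigr => k _; rewrite mxE normc_real real_normK ?num_real.
Qed.

(** A real matrix acts separately on real and imaginary parts, and the squared norms of the two
    parts add up. *)
Lemma norm2_toC_mulmx (R : realType) (n : nat) (H : 'M[R]_n) (delta : R)
    (z : 'cV[R[i]]_n) : 0 <= delta ->
  (forall x : 'cV[R]_n, norm2 (toC (H *m x)) <= delta * norm2 (toC x)) ->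
  norm2 (toC H *m z) <= delta * norm2 z.
Proof.
move=> d0 Hd.
pose x := map_mx (@complex.Re R) z; pose y := map_mx (@complex.Im R) z.
have sqrE (w : 'cV[R[i]]_n) : norm2 w ^+ 2 =
    norm2 (toC (map_mx (@complex.Re R) w)) ^+ 2 +
    norm2 (toC (map_mx (@complex.Im R) w)) ^+ 2.
  rewrite !norm2_real_sqr norm2_sqr -big_split /=; apply: eq_bigr => k _.
  rewrite !mxE; case: (w k 0) => a b /=.
  by rewrite sqr_sqrtr // addr_ge0 ?sqr_ge0.
have zE : z = toC x + 'i *: toC y.
  by apply/matrixP => k j; rewrite !mxE; exact: complexE.
have HE : toC H *m z = toC (H *m x) + 'i *: toC (H *m y).
  by rewrite {1}zE mulmxDr -scalemxAr /toC !map_mxM.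
have ReH : map_mx (@complex.Re R) (toC H *m z) = H *m x.
  rewrite HE; apply/matrixP => k j; rewrite !mxE /=.
  by rewrite mul0r mul1r subrr addr0.
have ImH : map_mx (@complex.Im R) (toC H *m z) = H *m y.
  rewrite HE; apply/matrixP => k j; rewrite !mxE /=.
  by rewrite mul0r mul1r !add0r.
rewrite -ler_sqr ?nnegrE ?mulr_ge0 ?norm2_ge0 // exprMn (sqrE (_ *m _)) (sqrE z).
rewrite ReH ImH mulrDr -!exprMn.
by apply: lerD; rewrite lerXn2r ?nnegrE ?mulr_ge0 ?norm2_ge0 ?Hd.
Qed.

(** The matrix determinant lemma: the bordered block matrix is factored in two ways, and the
    determinants are compared. *)
Lemma det_sub_rank1 (F : fieldType) (n : nat) (A : 'M[F]_n) (u v : 'cV[F]_n) :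
  A \in unitmx ->
  \det (A - u *m v^T) = \det A * (1 - (v^T *m (invmx A *m u)) 0 0).
Proof.
move=> Au.
have E1 : block_mx (A - u *m v^T) u 0 1%:M *m block_mx 1%:M 0 v^T 1%:M =
    block_mx A u v^T 1%:M.
  by rewrite mulmx_block !mulmx1 !mul0mx !mul1mx !mulmx0 !add0r subrK.
have E2 : block_mx A 0 v^T 1%:M *m
      block_mx 1%:M (invmx A *m u) 0 (1%:M - v^T *m (invmx A *m u)) =
    block_mx A u v^T 1%:M.
  rewrite mulmx_block !mulmx1 !mul0mx !mulmx0 !mul1mx !addr0 mulmxA mulmxV //.
  by rewrite mul1mx addrC subrK.
have := congr1 determinant (etrans E1 (esym E2)).
rewrite !det_mulmx !det_ublock !det_lblock !det1 !mulr1 !mul1r => ->.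
by rewrite det_mx11 !mxE.
Qed.

(* Dividing the eigenvector equation by the overlap with us gives
   (l - H) x = us with us^T x = 1; for two such solutions us^T (x - y) = 0, so
   the first-order term of l - r disappears. *)
Lemma large_eigenvalue_unique (R : realType) (n : nat) (us : 'cV[R[i]]_n)
    (H : 'M[R[i]]_n) (delta : R) (l r : R[i]) (x y : 'cV[R[i]]_n) :
  norm2 us = 1 -> (us^T *m us) 0 0 = 1 -> 0 <= delta <= 16^-1 ->
  (forall z, norm2 (H *m z) <= delta * norm2 z) ->
  2^-1 <= normc l -> 2^-1 <= normc r -> x != 0 -> y != 0 ->
  (us *m us^T + H) *m x = l *: x -> (us *m us^T + H) *m y = r *: y ->
  l = r.
Proof.
move=> us1 usus /andP[d0 d1] Hd l2 r2.
have normalize (m : R[i]) (z : 'cV[R[i]]_n) : 2^-1 <= normc m -> z != 0 ->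
    (us *m us^T + H) *m z = m *: z ->
    exists2 w, (us^T *m w) 0 0 = 1 & us + H *m w = m *: w.
  move=> m2 z0; rewrite mulmxDl -mulmxA.
  have -> : us *m (us^T *m z) = (us^T *m z) 0 0 *: us.
    by rewrite {1}[us^T *m z]mx11_scalar mul_mx_scalar.
  set a := (us^T *m z) 0 0 => Ez.
  (* With zero overlap, [z] would be an eigenvector of [H] for an eigenvalue of modulus at least
     1/2, against the norm bound 1/16. *)
  have [a0|a0] := eqVneq a 0.
    case/eqP: z0; apply: norm2_eq0.
    have := Hd z; rewrite a0 scale0r add0r in Ez; rewrite Ez norm2Z => Hz.
    have : (2^-1 - 16^-1) * norm2 z <= 0.
      rewrite mulrBl subr_le0; apply: le_trans (ler_wpM2r (norm2_ge0 z) m2) _.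
      by apply: le_trans Hz _; rewrite ler_wpM2r ?norm2_ge0.
    by rewrite pmulr_rle0 //; lra.
  exists (a^-1 *: z); first by rewrite -scalemxAr mxE mulVf.
  rewrite -scalemxAr scalerA mulrC -scalerA -Ez scalerDr scalerA mulVf //.
  by rewrite scale1r.
move=> x0 y0 /(normalize _ _ l2 x0) [{x0} v v1 Ev] /(normalize _ _ r2 y0) [{y0} w w1 Ew].
move: x y => _ _.
have Ez : l *: (v - w) = H *m (v - w) - (l - r) *: w.
  rewrite scalerBr mulmxBr scalerBl -Ev -Ew opprB addrA; congr (_ - _).
  by rewrite [us + H *m w]addrC addrA subrK addrC.
(* Multiply by [us^T]: the left side vanishes because [v] and [w] have the same overlap 1, and [w]
   contributes exactly [l - r]. *)
have lr : l - r = (us^T *m (H *m (v - w))) 0 0.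
  have := congr1 (fun z : 'cV_n => (us^T *m z) 0 0) Ez.
  rewrite -scalemxAr 2!mulmxBr -scalemxAr !mxE.
  move: v1 w1; rewrite !mxE => -> ->.
  by rewrite subrr mulr0 mulr1 => /eqP; rewrite eq_sym subr_eq0 => /eqP <-.
have lr_le : normc (l - r) <= delta * norm2 (v - w).
  rewrite lr (le_trans (normc_dot_le _ _)) // us1 mul1r; exact: Hd.
have w_le : 7 * norm2 w <= 16.
  have : norm2 (r *: w) <= 1 + delta * norm2 w.
    by rewrite -Ew (le_trans (norm2D _ _)) // us1 lerD2l Hd.
  rewrite norm2Z => rw.
  have := ler_wpM2r (norm2_ge0 w) r2; have := ler_wpM2r (norm2_ge0 w) d1.
  by lra.
have z_le : normc l * norm2 (v - w) <= delta * norm2 (v - w) * (1 + norm2 w).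
  rewrite -norm2Z Ez (le_trans (norm2D _ _)) // norm2N norm2Z mulrDr mulr1.
  by rewrite lerD ?Hd // ler_wpM2r ?norm2_ge0.
(* With [|l| >= 1/2], [delta <= 1/16] and [|w| <= 16/7], the bound [z_le] gives [c/2 <= (23/112) c]
   for [c = |v - w|]; hence [c = 0], and [lr_le] gives [l = r]. *)
suff z0 : norm2 (v - w) <= 0.
  apply/eqP; rewrite -subr_eq0; apply/eqP; apply: ComplexField.Normc.eq0_normc.
  apply/eqP; rewrite eq_le normc_ge0 andbT (le_trans lr_le) //.
  exact: mulr_ge0_le0.
have := norm2_ge0 (v - w); have := ler_wpM2r (norm2_ge0 (v - w)) l2.
have := ler_wpM2r (norm2_ge0 (v - w)) d1.
have := norm2_ge0 w.
move: z_le w_le; set c := norm2 _; set b := norm2 w; set a := normc l * c => z_le w_le b0 dc lc c0.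
have : delta * c * (1 + b) <= 16^-1 * c * (1 + b) by rewrite ler_wpM2r // addr_ge0.
have : c * (7 * b) <= c * 16 by rewrite ler_wpM2l.
by lra.
Qed.
Lemma horner_char_poly (F : fieldType) (n : nat) (A : 'M[F]_n) (t : F) :
  (char_poly A).[t] = \det (t%:M - A).
Proof.
rewrite /char_poly -horner_evalE -det_map_mx; congr (\det _).
by apply/matrixP => i j; rewrite !mxE /= horner_evalE !hornerE hornerMn hornerX.
Qed.

Lemma norm2_mulmx_small (R : realType) (n : nat) (H : 'M[R]_n) (delta t : R)
    (x : 'cV[R]_n) : delta < t ->
  (forall x : 'cV[R]_n, norm2 (toC (H *m x)) <= delta * norm2 (toC x)) ->
  H *m x = t *: x -> x = 0.
Proof.
move=> dt Hd Hx.
have : norm2 (toC x) <= 0.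
  have := Hd x; rewrite Hx /toC map_mxZ -/(toC x) norm2Z normc_real => H0.
  have := ler_wpM2r (norm2_ge0 (toC x)) (ler_norm t) => H1.
  have : (t - delta) * norm2 (toC x) <= 0.
    by rewrite mulrBl subr_le0 (le_trans H1).
  by rewrite pmulr_rle0 ?subr_gt0.
move/norm2_eq0 => /(congr1 (map_mx (@complex.Re R))) E.
by apply/matrixP => k j; have := congr1 (fun A : 'cV_n => A k j) E; rewrite !mxE.
Qed.

(* det(t - M) det(t - H) = det(t - H)^2 (1 - us^T (t - H)^-1 us) changes sign
   between 1/2 and 3/2, and the first determinant has to vanish. *)
Lemma large_real_eigenvalue (R : realType) (n : nat) (us : 'cV[R]_n)
    (H : 'M[R]_n) (delta : R) :
  norm2 (toC us) = 1 -> (us^T *m us) 0 0 = 1 -> 0 <= delta <= 16^-1 ->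
  (forall x : 'cV[R]_n, norm2 (toC (H *m x)) <= delta * norm2 (toC x)) ->
  exists2 r : R, 2^-1 <= r & root (char_poly (us *m us^T + H)) r.
Proof.
move=> us1 usus /andP[d0 d1] Hd.
have unitH t : 2^-1 <= t -> t%:M - H \in unitmx.
  move=> t2; rewrite unitmxE unitfE; apply/negP => /eqP detH.
  have /eqP/det0P [v v0] : \det (t%:M - H)^T = 0 by rewrite det_tr.
  move=> /(congr1 trmx); rewrite trmx_mul trmxK trmx0 mulmxBl mul_scalar_mx => /eqP.
  rewrite subr_eq0 => /eqP vH; case/eqP: v0; apply: trmx_inj; rewrite trmx0.
  by apply: (norm2_mulmx_small (delta := delta) (t := t) _ Hd) => //; lra.
(* One step of the resolvent expansion: [t x = us + H x], so [e] is the overlap of [us] with [H x],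
   of size at most [(1/16)(16/7)]. *)
have dot_le t : 2^-1 <= t ->
    exists e, [/\ `|e| <= 2^-1 & (us^T *m (invmx (t%:M - H) *m us)) 0 0 = t^-1 * (1 + e)].
  move=> t2; set x := invmx _ *m us.
  have xE : t *: x = us + H *m x.
    have := mulKVmx (unitH t t2) us; rewrite -/x mulmxBl mul_scalar_mx => /eqP.
    by rewrite subr_eq => /eqP.
  have x_le : 7 * norm2 (toC x) <= 16.
    have : norm2 (toC (t *: x)) <= 1 + delta * norm2 (toC x).
      rewrite xE /toC map_mxD (le_trans (norm2D _ _)) // us1 lerD2l; exact: Hd.
    rewrite /toC map_mxZ -/(toC x) norm2Z normc_real => tx.
    have := ler_wpM2r (norm2_ge0 (toC x)) (ler_norm t).
    have := ler_wpM2r (norm2_ge0 (toC x)) t2.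
    by have := ler_wpM2r (norm2_ge0 (toC x)) d1; lra.
  exists ((us^T *m (H *m x)) 0 0); split.
    have -> : `|(us^T *m (H *m x)) 0 0| = normc (((toC us)^T *m toC (H *m x)) 0 0).
      by rewrite /toC map_trmx -map_mxM [X in normc X]mxE normc_real.
    rewrite (le_trans (normc_dot_le _ _)) // us1 mul1r (le_trans (Hd x)) //.
    by have := ler_wpM2r (norm2_ge0 (toC x)) d1; lra.
  apply: (mulfI (x := t)); first by rewrite gt_eqF //; lra.
  rewrite mulrA divff ?mul1r; last by rewrite gt_eqF //; lra.
  have := congr1 (fun z : 'cV_n => (us^T *m z) 0 0) xE.
  by rewrite -scalemxAr mulmxDr [X in X = _]mxE [X in _ = X]mxE usus => ->.
set M := us *m us^T + H.
pose p := char_poly M * char_poly H.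
have pE t : 2^-1 <= t -> p.[t] =
    \det (t%:M - H) ^+ 2 * (1 - (us^T *m (invmx (t%:M - H) *m us)) 0 0).
  move=> t2; rewrite hornerM !horner_char_poly /M.
  have -> : t%:M - (us *m us^T + H) = (t%:M - H) - us *m us^T.
    by rewrite opprD addrA addrAC.
  by rewrite det_sub_rank1 ?unitH //; ring.
have half_le : 2^-1 <= 3 / 2 :> R by lra.
(* For [|e| <= 1/2], the factor [1 - 2 (1 + e)] is at most 0 and [1 - (2/3)(1 + e)] at least 0; this
   fixes the endpoints 1/2 and 3/2. *)
have : p.[2^-1] * p.[3 / 2] <= 0.
  rewrite !pE //; apply: mulr_le0_ge0.
    have [e [e2 ->]] := dot_le _ (lexx _).
    apply: mulr_ge0_le0; first exact: sqr_ge0.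
    by move: e2; rewrite ler_norml invrK => /andP[]; lra.
  have [e [e2 ->]] := dot_le _ half_le.
  apply: mulr_ge0; first exact: sqr_ge0.
  by move: e2; rewrite ler_norml invfM invrK => /andP[]; lra.
case/(polyrcf.poly_ivt half_le) => r; rewrite in_itv /= => /andP[r2 _].
rewrite rootM => /orP[rM|]; first by exists r.
(* The root cannot come from the auxiliary factor [char_poly H], because [r - H] is invertible. *)
rewrite rootE horner_char_poly => /eqP detH.
by have := unitH r r2; rewrite unitmxE detH unitr0.
Qed.

Lemma norm_inf_le (R : realType) (n : nat) (v : 'cV[R[i]]_n) (K : R) :
  0 <= K -> (forall k, normc (v k 0) <= K) -> norm_inf v <= K.
Proof. by move=> K0 vK; apply: bigmax_le. Qed.

(** The fixed-point equation is substituted into itself; stopping after [N] rounds keeps an explicit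
    remainder in place of a convergent series. *)
Lemma neumann_expansion (R : realType) (n N : nat) (H : 'M[R]_n)
    (us v : 'cV[R]_n) (b r : R) : v = b *: us + r^-1 *: (H *m v) ->
  v = r ^- N *: iter N (mulmx H) v +
      b *: \sum_(s < N) r ^- s *: iter s (mulmx H) us.
Proof.
move=> vE; elim: N => [|N IH].
  by rewrite big_ord0 scaler0 addr0 expr0 invr1 scale1r.
rewrite {1}vE {1}IH mulmxDr -!scalemxAr scalerDr !scalerA.
rewrite big_ord_recl expr0 invr1 scale1r [in RHS]scalerDr [in RHS]addrCA.
rewrite -invfM -exprS; congr (_ + (_ + _)).
rewrite mulrC -scalerA mulmx_sumr scaler_sumr; congr (_ *: _).
by apply: eq_bigr => s _; rewrite -scalemxAr scalerA -invfM -exprS.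
Qed.

Lemma geometric_sum_le (R : realType) (q : R) (m : nat) : 0 <= q <= 2^-1 ->
  \sum_(i < m) q ^+ i.+1 <= 2 * q.
Proof.
(* The factor [1 - 2^-m] is the slack that lets the induction on [m] close. *)
move=> /andP[q0 q2]; suff H : \sum_(i < m) q ^+ i.+1 <= 2 * q * (1 - 2^-1 ^+ m).
  have h0 : 0 <= (2^-1 : R) ^+ m by rewrite exprn_ge0 ?invr_ge0.
  by apply: le_trans H _; nra.
elim: m => [|m IH]; first by rewrite big_ord0 expr0 subrr mulr0.
rewrite big_ord_recr /= (le_trans (lerD IH (lexx _))) //.
have : q * q ^+ m <= q * 2^-1 ^+ m by rewrite ler_wpM2l // lerXn2r ?nnegrE ?invr_ge0.
by rewrite !exprS; lra.
Qed.

Lemma norm2_iter_mulmx (R : realType) (n N : nat) (H : 'M[R]_n) (delta : R)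
    (v : 'cV[R]_n) : 0 <= delta ->
  (forall x : 'cV[R]_n, norm2 (toC (H *m x)) <= delta * norm2 (toC x)) ->
  norm2 (toC (iter N (mulmx H) v)) <= delta ^+ N * norm2 (toC v).
Proof.
move=> d0 Hd; elim: N => [|N IH]; first by rewrite expr0 mul1r.
by rewrite /= (le_trans (Hd _)) // exprS -mulrA ler_wpM2l.
Qed.

(** The deterministic core, normalised to [lambda = 1]. The entrywise bounds control the first [L]
    corrections in the expansion of the eigenvector; the operator norm alone controls the tail,
    which is exponentially small in [L]. *)
Lemma leading_eigenvector_perturbation (R : realType) (n L : nat)
    (us : 'cV[R]_n) (H : 'M[R]_n) (delta kappa : R) (u : 'cV[R[i]]_n) :
  norm2 (toC us) = 1 -> 0 <= delta <= 16^-1 ->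
  (forall x : 'cV[R]_n, norm2 (toC (H *m x)) <= delta * norm2 (toC x)) ->
  (forall s k, (s <= L)%N ->
     `|iter s (mulmx H) us k 0| <= delta ^+ s * kappa) ->
  2^-1 ^+ L <= kappa ->
  is_leading_eigenvector (us *m us^T + H) u ->
  Num.min (norm_inf (u - toC us)) (norm_inf (u + toC us)) <= 12 * delta * kappa.
Proof.
move=> us1 d01 Hd Hs Lk [l [[_ lmax] Hu u1 ureal]].
have /andP[d0 d1] := d01.
have k0 : 0 <= kappa by apply: le_trans Lk; rewrite exprn_ge0 ?invr_ge0.
have usus : (us^T *m us) 0 0 = 1.
  rewrite -[RHS](expr1n _ 2) -us1 norm2_real_sqr mxE.
  by apply: eq_bigr => k _; rewrite mxE -expr2.
have [r r2 rM] := large_real_eigenvalue us1 usus d01 Hd.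
(* Being of maximal modulus, [l] satisfies [|l| >= |r| >= 1/2], so uniqueness of the large
   eigenvalue identifies it with the real root [r]. *)
have lr : l = r%:C.
  have toCM : toC (us *m us^T + H) = toC us *m (toC us)^T + toC H.
    by rewrite /toC map_mxD map_mxM map_trmx.
  have [y y0 Hy] : exists2 y : 'cV[R]_n, y != 0 & (us *m us^T + H) *m y = r *: y.
    have /eqP/det0P [y y0] : \det (r%:M - (us *m us^T + H))^T = 0.
      by rewrite det_tr -horner_char_poly; apply/eqP.
    move=> /(congr1 trmx); rewrite trmx_mul trmxK trmx0 mulmxBl mul_scalar_mx => /eqP.
    rewrite subr_eq0 => /eqP Hy; exists y^T; last by rewrite Hy.
    by apply: contra_neq y0 => y0; apply: trmx_inj; rewrite y0 trmx0.
  have rC : 2^-1 <= normc r%:C by rewrite normc_real (le_trans r2) ?ler_norm.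
  apply: (large_eigenvalue_unique (us := toC us) (H := toC H) (delta := delta)
            (x := u) (y := toC y)) => //.
  - by rewrite /toC map_trmx -map_mxM mxE usus.
  - by move=> z; apply: norm2_toC_mulmx.
  - rewrite (le_trans rC) // -lecR; apply: lmax.
    by rewrite eigenvalue_root_char /toC -map_char_poly fmorph_root.
  - apply/eqP => u0; move: u1; rewrite u0 /norm2 big1 ?sqrtr0 => [/eqP|k _].
      by rewrite eq_sym oner_eq0.
    by rewrite mxE ComplexField.Normc.normc0 expr0n.
  - apply: contra_neq y0 => /matrixP y0; apply/matrixP => i j.
    by have /eqP := y0 i j; rewrite !mxE fmorph_eq0 => /eqP.
  - by rewrite -toCM.
  - by rewrite -toCM /toC -map_mxM Hy map_mxZ.
have {ureal} : u \is a mxOver Num.real by apply: ureal; rewrite lr; apply/complex_realP; exists r.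
move=> /mxOverP ureal.
have [v uE] : exists v, u = toC v.
  exists (map_mx (@complex.Re R) u); apply/matrixP => i j; rewrite !mxE.
  by rewrite [LHS](esym (RRe_real (ureal i j))).
move: Hu u1; rewrite {}uE lr => Hv v1 {u lmax ureal lr l}.
have r0 : r != 0 by rewrite gt_eqF //; lra.
have vE : v = ((us^T *m v) 0 0 / r) *: us + r^-1 *: (H *m v).
  have Hv' : (us *m us^T + H) *m v = r *: v.
    apply: (map_mx_inj (f := real_complex R)).
    by rewrite map_mxZ map_mxM.
  apply: (scalerI r0); rewrite scalerDr !scalerA mulfV // scale1r mulrCA mulfV // mulr1.
  rewrite -Hv' mulmxDl -mulmxA.
  by rewrite {1}[us^T *m v]mx11_scalar mul_mx_scalar.
set b := (us^T *m v) 0 0 / r in vE.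
have rV : r^-1 <= 2 by rewrite -[2]invrK lef_pV2 ?posrE //; lra.
have rV0 : 0 <= r^-1 by rewrite invr_ge0; lra.
(* The difference is [r^-1 H v] with [r^-1 <= 2]. Since [v] and [us] are unit vectors, [|b|] is then
   within [2 delta] of 1. *)
have dist : norm2 (toC (v - b *: us)) <= 2 * delta.
  rewrite {1}vE addrAC subrr add0r /toC map_mxZ norm2Z normc_real ger0_norm //.
  have := Hd v; rewrite v1 mulr1 => Hv1.
  apply: ler_pM => //; exact: norm2_ge0.
have b_norm : norm2 (toC (b *: us)) = `|b|.
  by rewrite /toC map_mxZ norm2Z normc_real us1 mulr1.
have b_le : `|b| - 1 <= 2 * delta.
  have := norm2D (toC v) (toC (- (v - b *: us))).
  rewrite /toC -map_mxD opprB addrC subrK b_norm v1 -[X in _ + norm2 X]opprK norm2N.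
  by rewrite -map_mxN opprB; move: dist; rewrite /toC; lra.
have b_ge : 1 - `|b| <= 2 * delta.
  have := norm2D (toC (b *: us)) (toC (v - b *: us)).
  by rewrite /toC -map_mxD addrC subrK b_norm v1; move: dist; rewrite /toC; lra.
(* The constant 10 is 2 + 8. The remainder after [L.+1] terms is at most
   [(2 delta)^(L+1) <= 2 delta kappa]; the terms from 1 to [L] form a geometric sum of at most
   [4 delta kappa], multiplied by [|b| <= 2]. *)
have entry k : `|v k 0 - b * us k 0| <= 10 * delta * kappa.
  have q2 : 0 <= 2 * delta <= 2^-1 by lra.
  have t1 : `|r ^- L.+1 * iter L.+1 (mulmx H) v k 0| <= 2 * delta * kappa.
    rewrite normrM (le_trans (y := (2 ^+ L.+1) * delta ^+ L.+1)) //.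
      rewrite ler_pM // ?normr_ge0 //.
        by rewrite -exprVn normrX ger0_norm // lerXn2r ?nnegrE.
      rewrite -normc_real; have := normc_le_norm2 (toC (iter L.+1 (mulmx H) v)) k.
      rewrite mxE => /le_trans; apply; rewrite -[leRHS]mulr1 -v1.
      exact: norm2_iter_mulmx.
    rewrite -exprMn exprS ler_wpM2l ?mulr_ge0 // (le_trans _ Lk) //.
    by rewrite lerXn2r ?nnegrE ?invr_ge0 ?mulr_ge0 //; case/andP: q2.
  have t2 : `|b * \sum_(i < L) (r ^- bump 0 i *: iter (bump 0 i) (mulmx H) us) k 0|
      <= 2 * (2 * (2 * delta) * kappa).
    rewrite normrM ler_pM //; first by lra.
    rewrite (le_trans (ler_norm_sum _ _ _)) //.
    apply: (@le_trans _ _ (\sum_(i < L) (2 * delta) ^+ i.+1 * kappa)).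
      apply: ler_sum => i _; rewrite mxE normrM exprMn -mulrA /bump leq0n add1n.
      rewrite ler_pM //; first by rewrite -exprVn normrX ger0_norm // lerXn2r ?nnegrE.
      by apply: Hs.
    by rewrite -mulr_suml ler_wpM2r // geometric_sum_le.
  move: (neumann_expansion L.+1 vE) t1; move: (iter L.+1 _ v) => w.
  rewrite big_ord_recl expr0 invr1 scale1r scalerDr [RHS]addrCA => E t1.
  have -> : v k 0 - b * us k 0 = r ^- L.+1 * w k 0 +
      b * \sum_(i < L) (r ^- bump 0 i *: iter (bump 0 i) (mulmx H) us) k 0.
    by rewrite {1}E !mxE summxE addrAC subrr add0r.
  apply: le_trans (ler_normD _ _) _; apply: le_trans (lerD t1 t2) _; lra.
have us_le k : `|us k 0| <= kappa by have := Hs 0%N k (leq0n _); rewrite /= expr0 mul1r.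
have dk0 : 0 <= 12 * delta * kappa by rewrite !mulr_ge0.
(* Used with [e] equal to 1 or -1, the sign of [b]; replacing [b] by its sign costs another
   [2 delta kappa]. *)
have close e : `|b - e| <= 2 * delta -> norm_inf (toC v - e%:C *: toC us) <= 12 * delta * kappa.
  move=> be; apply: norm_inf_le => // k.
  have -> : (toC v - e%:C *: toC us) k 0 = (v k 0 - e * us k 0)%:C.
    by rewrite !mxE rmorphB rmorphM.
  rewrite normc_real.
  have -> : v k 0 - e * us k 0 = (v k 0 - b * us k 0) + (b - e) * us k 0 by ring.
  apply: le_trans (ler_normD _ _) _; rewrite normrM.
  have : `|b - e| * `|us k 0| <= 2 * delta * kappa by rewrite ler_pM.
  by have := entry k; lra.
rewrite ge_min; have [b0|b0] := leP 0 b.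
  apply/orP; left; rewrite -[toC us]scale1r; apply: (close 1).
  by move: b_le b_ge; rewrite ger0_norm // ler_norml => ? ?; apply/andP; split; lra.
apply/orP; right; have -> : toC v + toC us = toC v - (-1)%:C *: toC us.
  by rewrite rmorphN1 scaleN1r opprK.
apply: close.
move: b_le b_ge; rewrite ltr0_norm // ler_norml => ? ?; apply/andP; split; lra.
Qed.

(** * From entries of Gram powers to the operator norm *)

Lemma dot_le_norm2 (R : realType) (n : nat) (x y : 'cV[R]_n) :
  (x^T *m y) 0 0 <= norm2 (toC x) * norm2 (toC y).
Proof.
apply: le_trans (ler_norm _) _; rewrite -normc_real.
have -> : ((x^T *m y) 0 0)%:C = ((toC x)^T *m toC y) 0 0.
  by rewrite /toC map_trmx -map_mxM [RHS]mxE.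
exact: normc_dot_le.
Qed.

Lemma dot_self (R : realType) (n : nat) (x : 'cV[R]_n) :
  (x^T *m x) 0 0 = norm2 (toC x) ^+ 2.
Proof.
rewrite norm2_real_sqr mxE; apply: eq_bigr => k _; by rewrite mxE expr2.
Qed.

(** Cauchy-Schwarz on each row: the Frobenius norm of [G] is at most [n * c]. *)
Lemma norm2_mulmx_entry (R : realType) (n : nat) (G : 'M[R]_n) (c : R)
    (x : 'cV[R]_n) : (forall i j, `|G i j| <= c) ->
  norm2 (toC (G *m x)) <= n%:R * c * norm2 (toC x).
Proof.
move=> Gc; case: n => [|n] in G x Gc *.
  by rewrite !mul0r /norm2 big_ord0 sqrtr0.
have c0 : 0 <= c by apply: le_trans (Gc ord0 ord0).
rewrite -ler_sqr ?nnegrE ?mulr_ge0 ?norm2_ge0 //.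
rewrite norm2_real_sqr.
have row_le i : (G *m x) i 0 ^+ 2 <= n.+1%:R * c ^+ 2 * norm2 (toC x) ^+ 2.
  have -> : (G *m x) i 0 = ((row i G)^T^T *m x) 0 0.
    by rewrite trmxK -row_mul [RHS]mxE.
  apply: (@le_trans _ _ ((norm2 (toC (row i G)^T) * norm2 (toC x)) ^+ 2)).
    rewrite -[leLHS]real_normK ?num_real // lerXn2r ?nnegrE ?mulr_ge0 ?norm2_ge0 //.
    rewrite ler_norml dot_le_norm2 andbT lerNl.
    have := dot_le_norm2 (- (row i G)^T) x.
    by rewrite linearN /= mulNmx [X in X <= _]mxE /toC map_mxN norm2N.
  rewrite exprMn ler_wpM2r ?sqr_ge0 // norm2_real_sqr.
  rewrite mulr_natl -[X in _ *+ X]card_ord -sumr_const; apply: ler_sum => j _.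
  by rewrite !mxE -real_normK ?num_real // lerXn2r ?nnegrE.
apply: (le_trans (ler_sum _ (fun i _ => row_le i))).
rewrite sumr_const card_ord -[X in X <= _]mulr_natl le_eqVlt; apply/orP; left.
by apply/eqP; ring.
Qed.

(* The norms of the iterates of a symmetric matrix are log-convex, so an
   entrywise bound on a high power of H^T H controls the operator norm of H. *)
Lemma norm2_mulmx_gram (R : realType) (n L : nat) (H : 'M[R]_n) (D : R)
    (x : 'cV[R]_n) : (0 < L)%N -> (n <= 2 ^ L)%N -> 0 <= D ->
  (forall i j, `|iter L (fun w => H^T *m (H *m w)) (delta_mx j 0 : 'cV_n) i 0| <=
     D ^+ L.*2) ->
  norm2 (toC (H *m x)) <= 2 * D * norm2 (toC x).
Proof.
move=> L0 nL D0 HL.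
set g := fun w : 'cV[R]_n => H^T *m (H *m w) in HL.
pose a k := norm2 (toC (iter k g x)).
have a_ge0 k : 0 <= a k by exact: norm2_ge0.
have g_sym y z : (g y)^T *m z = y^T *m g z.
  by rewrite /g !trmx_mul trmxK !mulmxA.
have logconv k : a k.+1 ^+ 2 <= a k * a k.+2.
  rewrite -dot_self [in X in X <= _]iterS g_sym; exact: dot_le_norm2.
(* Log-convexity makes the successive ratios nondecreasing, so none is below the first;
   cross-multiplication allows iterates of norm 0. *)
have ratio k : a 1%N * a k <= a k.+1 * a 0%N.
  elim: k => [|k IH]; first by [].
  have [ak|ak] := leP (a k.+1) 0.
    have -> : a k.+1 = 0 by apply/eqP; rewrite eq_le ak a_ge0.
    by rewrite mulr0 mulr_ge0.
  rewrite -(ler_pM2r ak).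
  have h1 := ler_wpM2l (a_ge0 1%N) (logconv k).
  have h2 := ler_wpM2r (a_ge0 k.+2) IH.
  by nra.
have power k : a 1%N ^+ k.+1 <= a k.+1 * a 0%N ^+ k.
  elim: k => [|k IH]; first by rewrite expr0 mulr1 expr1.
  rewrite exprS (le_trans (ler_wpM2l (a_ge0 1%N) IH)) // mulrA.
  by rewrite exprS mulrA ler_wpM2r ?exprn_ge0.
have aL : a L <= n%:R * D ^+ L.*2 * a 0%N.
  have [G GE] : exists G : 'M[R]_n, forall y, iter L g y = G *m y.
    elim: (L) => [|k [G GE]]; first by exists 1%:M => y; rewrite mul1mx.
    by exists (H^T *m (H *m G)) => y; rewrite iterS GE /g !mulmxA.
  rewrite /a GE; apply: norm2_mulmx_entry => i j.
  by have := HL i j; rewrite GE -colE mxE.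
(* Taking the [L]-th root turns the dimension factor into at most 2, because [n <= 2 ^ L]. *)
have a1 : a 1%N <= 2 * D ^+ 2 * a 0%N.
  case: L L0 nL aL {HL} => // k _ nk ak.
  rewrite -(ler_pXn2r (n := k.+1)) ?nnegrE ?mulr_ge0 ?exprn_ge0 //.
  rewrite (le_trans (power k)) // (le_trans (ler_wpM2r (exprn_ge0 k (a_ge0 0%N)) ak)) //.
  rewrite -[leLHS]mulrA -(exprS (a 0%N) k) [in leRHS]exprMn ler_wpM2r ?exprn_ge0 //.
  rewrite exprMn -exprM -mul2n ler_wpM2r ?exprn_ge0 //.
  by rewrite -natrX ler_nat.
rewrite -ler_sqr ?nnegrE ?mulr_ge0 ?norm2_ge0 // -dot_self trmx_mul -mulmxA.
apply: (le_trans (dot_le_norm2 _ _)).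
rewrite -/(g x) -[norm2 (toC (g x))]/(a 1%N) -[norm2 (toC x)]/(a 0%N).
have h1 := ler_wpM2l (a_ge0 0%N) a1.
have : 0 <= a 0%N ^+ 2 * D ^+ 2 by rewrite mulr_ge0 ?sqr_ge0.
by move: h1; rewrite !exprMn; nra.
Qed.

(** * Moments of truncated independent noise *)

(** A class closed under sums and products, all of whose members are integrable under a probability;
    linearity of the mean then applies to every walk expansion. *)
Definition bounded_measurable (d : measure_display) (T : measurableType d)
    (R : realType) (f : T -> R) : Prop :=
  measurable_fun setT f /\ exists M, forall w, `|f w| <= M.

Notation mean P f := (Rintegral P setT f).

Lemma bounded_measurable_cst (d : measure_display) (T : measurableType d)
    (R : realType) (c : R) : bounded_measurable (fun _ : T => c).
Proof. by split; [exact: measurable_cst | exists `|c|]. Qed.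

Lemma bounded_measurable_indic (d : measure_display) (T : measurableType d)
    (R : realType) (A : set T) : measurable A ->
  bounded_measurable (\1_A : T -> R).
Proof.
move=> mA; split; first exact: measurable_indic.
by exists 1 => w; rewrite indicE; case: (_ \in _); rewrite ?normr1 ?normr0.
Qed.

Lemma bounded_measurableD (d : measure_display) (T : measurableType d)
    (R : realType) (f g : T -> R) : bounded_measurable f -> bounded_measurable g ->
  bounded_measurable (fun w => f w + g w).
Proof.
move=> [mf [M fM]] [mg [N gN]]; split; first exact: measurable_funD.
by exists (M + N) => w; rewrite (le_trans (ler_normD _ _)) ?lerD.
Qed.

Lemma bounded_measurableM (d : measure_display) (T : measurableType d)
    (R : realType) (f g : T -> R) : bounded_measurable f -> bounded_measurable g ->
  bounded_measurable (fun w => f w * g w).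
Proof.
move=> [mf [M fM]] [mg [N gN]]; split; first exact: measurable_funM.
by exists (M * N) => w; rewrite normrM ler_pM.
Qed.

Lemma bounded_measurableZ (d : measure_display) (T : measurableType d)
    (R : realType) (c : R) (f : T -> R) : bounded_measurable f ->
  bounded_measurable (fun w => c * f w).
Proof. by apply: bounded_measurableM; exact: bounded_measurable_cst. Qed.

Lemma bounded_measurable_sum (d : measure_display) (T : measurableType d)
    (R : realType) (I : Type) (r : seq I) (F : I -> T -> R) :
  (forall i, bounded_measurable (F i)) ->
  bounded_measurable (fun w => \sum_(i <- r) F i w).
Proof.
move=> bF; elim: r => [|i r IH].
  by under [X in bounded_measurable X]eq_fun do rewrite big_nil;
     exact: bounded_measurable_cst.
by under [X in bounded_measurable X]eq_fun do rewrite big_cons;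
   exact: bounded_measurableD.
Qed.

Lemma bounded_measurable_prod (d : measure_display) (T : measurableType d)
    (R : realType) (I : Type) (r : seq I) (Q : pred I) (F : I -> T -> R) :
  (forall i, bounded_measurable (F i)) ->
  bounded_measurable (fun w => \prod_(i <- r | Q i) F i w).
Proof.
move=> bF; elim: r => [|i r IH].
  by under [X in bounded_measurable X]eq_fun do rewrite big_nil;
     exact: bounded_measurable_cst.
under [X in bounded_measurable X]eq_fun do rewrite big_cons.
by case: (Q i) => //; exact: bounded_measurableM.
Qed.

Lemma bounded_measurable_expr (d : measure_display) (T : measurableType d)
    (R : realType) (k : nat) (f : T -> R) : bounded_measurable f ->
  bounded_measurable (fun w => f w ^+ k).
Proof.
move=> [mf [M fM]]; split; first exact: measurable_funX.
by exists (M ^+ k) => w; rewrite normrX lerXn2r ?nnegrE // (le_trans _ (fM w)).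
Qed.

Lemma bounded_measurable_comp (d d' : measure_display) (T : measurableType d)
    (U : measurableType d') (R : realType) (f : U -> R) (X : T -> U) :
  bounded_measurable f -> measurable_fun setT X ->
  bounded_measurable (fun w => f (X w)).
Proof.
move=> [mf [M fM]] mX; split; first exact: measurableT_comp.
by exists M => w.
Qed.

Lemma bounded_measurable_integrable (d : measure_display) (T : measurableType d)
    (R : realType) (P : probability T R) (f : T -> R) :
  bounded_measurable f -> P.-integrable setT (EFin \o f).
Proof.
move=> [mf [M fM]]; apply: measurable_bounded_integrable => //.
  by apply: le_lt_trans (probability_le1 P measurableT) _; exact: ltry.
exists M; split; first exact: num_real.
by move=> x Mx w _; exact: le_trans (fM w) (ltW Mx).
Qed.

Lemma mean_cst (d : measure_display) (T : measurableType d)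
    (R : realType) (P : probability T R) (c : R) : mean P (fun _ : T => c) = c.
Proof. by rewrite /Rintegral; have := expectation_cst P c; rewrite unlock => ->. Qed.

Lemma meanD (d : measure_display) (T : measurableType d)
    (R : realType) (P : probability T R) (f g : T -> R) :
  bounded_measurable f -> bounded_measurable g ->
  mean P (fun w => f w + g w) = mean P f + mean P g.
Proof. by move=> bf bg; apply: RintegralD => //; exact: bounded_measurable_integrable. Qed.

Lemma meanZ (d : measure_display) (T : measurableType d)
    (R : realType) (P : probability T R) (c : R) (f : T -> R) :
  bounded_measurable f -> mean P (fun w => c * f w) = c * mean P f.
Proof. by move=> bf; apply: RintegralZl => //; exact: bounded_measurable_integrable. Qed.

Lemma mean_sum (d : measure_display) (T : measurableType d)
    (R : realType) (P : probability T R) (I : Type) (r : seq I) (F : I -> T -> R) :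
  (forall i, bounded_measurable (F i)) ->
  mean P (fun w => \sum_(i <- r) F i w) = \sum_(i <- r) mean P (F i).
Proof.
move=> bF; elim: r => [|i r IH].
  rewrite big_nil -[RHS](mean_cst P).
  by apply: eq_Rintegral => w _; rewrite big_nil.
rewrite big_cons -IH -meanD //; last exact: bounded_measurable_sum.
by apply: eq_Rintegral => w _; rewrite big_cons.
Qed.

Lemma mean_le (d : measure_display) (T : measurableType d)
    (R : realType) (P : probability T R) (f g : T -> R) :
  bounded_measurable f -> bounded_measurable g -> (forall w, f w <= g w) ->
  mean P f <= mean P g.
Proof.
by move=> bf bg fg; apply: le_Rintegral => //; exact: bounded_measurable_integrable.
Qed.

Lemma mean_norm_le (d : measure_display) (T : measurableType d)
    (R : realType) (P : probability T R) (f : T -> R) (M : R) :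
  bounded_measurable f -> (forall w, `|f w| <= M) -> `|mean P f| <= M.
Proof.
move=> bf fM; rewrite ler_norml -(mean_cst P (- M)) -[X in _ && (_ <= X)](mean_cst P M).
by apply/andP; split; apply: mean_le => //; try exact: bounded_measurable_cst;
  move=> w; have := fM w; rewrite ler_norml => /andP[].
Qed.

Lemma mean_indic (d : measure_display) (T : measurableType d)
    (R : realType) (P : probability T R) (A : set T) :
  measurable A -> mean P (\1_A : T -> R) = fine (P A).
Proof. by move=> mA; rewrite /Rintegral integral_indic // setIT. Qed.

(** The sum counts the positive multiples of [e] not exceeding [y], so it is [y] rounded down to the
    grid. *)
Lemma staircase_approximation (R : realType) (e y : R) (K : nat) :
  0 < e -> 0 <= y <= K%:R * e ->
  `|y - \sum_(j < K) e * (j.+1%:R * e <= y)%R%:R| <= e.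
Proof.
move=> e0; elim: K => [|K IH] /andP[y0 yK].
  by move: yK; rewrite big_ord0 mul0r subr0 ger0_norm // => /le_trans; apply; exact: ltW.
rewrite big_ord_recr /=; have [yK'|yK'] := leP y (K%:R * e).
  have -> : (K.+1%:R * e <= y) = false.
    by apply/negbTE; rewrite -ltNge (le_lt_trans yK') // ltr_pM2r ?ltr_nat.
  by rewrite mulr0 addr0; apply: IH; rewrite y0.
rewrite (eq_bigr (fun _ => e)) => [|j _]; last first.
  suff -> : j.+1%:R * e <= y by rewrite mulr1.
  by apply: le_trans (ltW yK'); rewrite ler_pM2r // ler_nat.
rewrite sumr_const card_ord -mulr_natl.
move: yK; rewrite -natr1 mulrDl mul1r => yK.
have [h|h] := leP (K%:R * e + e) y; rewrite /= ?mulr1 ?mulr0 ler_norml; lra.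
Qed.

(* A bounded function is uniformly close to a combination of indicators of its
   superlevel sets. *)
Lemma mean_comp_eq (d : measure_display) (T : measurableType d) (R : realType)
    (P : probability T R) (X X' Y Y' : T -> R) :
  measurable_fun setT X -> measurable_fun setT X' ->
  bounded_measurable Y -> bounded_measurable Y' ->
  (forall A : set R, measurable A ->
     mean P (fun w => Y w * \1_A (X w)) = mean P (fun w => Y' w * \1_A (X' w))) ->
  forall f : R -> R, bounded_measurable f ->
     mean P (fun w => Y w * f (X w)) = mean P (fun w => Y' w * f (X' w)).
Proof.
move=> mX mX' bY bY' ind f bf; have [mf [M fM]] := bf.
have [_ [N YN]] := bY; have [_ [N' YN']] := bY'.
have M0 : 0 <= M by apply: le_trans (fM 0).
have close e : 0 < e ->
    `|mean P (fun w => Y w * f (X w)) - mean P (fun w => Y' w * f (X' w))| <=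
    (N + N') * e.
  move=> e0.
  (* Enough grid levels to cover [[0, 2 M]], the range of the shifted function [f + M]. *)
  have [K KM] : exists K : nat, 2 * M <= K%:R * e.
    exists (Num.bound (2 * M / e)); rewrite -ler_pdivrMr //.
    by apply: ltW; apply: archi_boundP; rewrite divr_ge0 ?mulr_ge0 // ltW.
  pose A j := [set x : R | j.+1%:R * e <= f x + M].
  pose s x : R := - M + \sum_(j < K) e * \1_(A j) x.
  have mA j : measurable (A j).
    have -> : A j = (fun x => f x + M) @^-1` `[j.+1%:R * e, +oo[%classic.
      by apply/seteqP; split => x; rewrite /A /= in_itv /= andbT.
    have mfM : measurable_fun setT (fun x => f x + M) by exact: measurable_funD.
    by rewrite -[X in measurable X]setTI; apply: mfM; rewrite //; exact: measurable_itv.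
  have bA j := bounded_measurable_indic R (mA j).
  have bs : bounded_measurable s.
    apply: bounded_measurableD; first exact: bounded_measurable_cst.
    by apply: bounded_measurable_sum => j; exact: bounded_measurableZ.
  have sE : forall x, `|f x - s x| <= e.
    move=> x; have -> : f x - s x = f x + M - \sum_(j < K) e * (j.+1%:R * e <= f x + M)%R%:R.
      rewrite /s opprD opprK addrA; congr (_ - _); apply: eq_bigr => j _.
      rewrite indicE; congr (_ * _%:R); congr nat_of_bool.
      by apply/idP/idP; rewrite inE.
    apply: staircase_approximation => //.
    by have := fM x; rewrite ler_norml => /andP[? ?]; apply/andP; split; lra.
  have bdiff : bounded_measurable (fun x => f x - s x).
    apply: bounded_measurableD => //.
    by under [X in bounded_measurable X]eq_fun do rewrite -mulN1r; exact: bounded_measurableZ.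
  have meansE Z W : measurable_fun setT W -> bounded_measurable Z ->
      mean P (fun w => Z w * s (W w)) = - M * mean P (fun w => Z w * \1_setT (W w)) +
        \sum_(j < K) e * mean P (fun w => Z w * \1_(A j) (W w)).
    move=> mW bZ.
    have bZA (B : set R) : measurable B -> bounded_measurable (fun w => Z w * \1_B (W w)).
      move=> mB; apply: bounded_measurableM => //; apply: bounded_measurable_comp mW.
      exact: bounded_measurable_indic.
    rewrite -meanZ; last exact: bZA.
    rewrite (eq_bigr (fun j : 'I_K => mean P (fun w => e * (Z w * \1_(A j) (W w)))));
      last by move=> j _; rewrite meanZ //; exact: bZA.
    rewrite -mean_sum; last by move=> j; apply: bounded_measurableZ; exact: bZA.
    rewrite -meanD; first last.
    - by apply: bounded_measurable_sum => j; apply: bounded_measurableZ; exact: bZA.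
    - by apply: bounded_measurableZ; exact: bZA.
    apply: eq_Rintegral => w _; rewrite /s mulrDr indicT mulr1 mulrC; congr (_ + _).
    by rewrite mulr_sumr; apply: eq_bigr => j _; rewrite mulrCA.
  have splitE Z W : measurable_fun setT W -> bounded_measurable Z ->
      mean P (fun w => Z w * f (W w)) = mean P (fun w => Z w * s (W w)) +
        mean P (fun w => Z w * (f (W w) - s (W w))).
    move=> mW bZ; rewrite -meanD.
    - by apply: eq_Rintegral => w _; rewrite -mulrDr addrC subrK.
    - by apply: bounded_measurableM => //; exact: bounded_measurable_comp.
    - by apply: bounded_measurableM => //; exact: (bounded_measurable_comp bdiff).
  have small Z W c : measurable_fun setT W -> bounded_measurable Z ->
      (forall w, `|Z w| <= c) ->
      `|mean P (fun w => Z w * (f (W w) - s (W w)))| <= c * e.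
    move=> mW bZ Zc; apply: mean_norm_le.
      by apply: bounded_measurableM => //; exact: (bounded_measurable_comp bdiff).
    by move=> w; rewrite normrM ler_pM.
  rewrite !splitE // !meansE // ind //.
  under eq_bigr => j _ do rewrite ind //.
  rewrite opprD addrACA subrr add0r mulrDl (le_trans (ler_normB _ _)) //.
  by apply: lerD; apply: small.
have NN0 : 0 <= N + N' by apply: addr_ge0; [apply: le_trans (YN point)|apply: le_trans (YN' point)].
(* The error is below every positive [e]; the added 1 in the denominator guards against
   [N + N' = 0]. *)
apply/eqP; rewrite -subr_eq0 -normr_le0; apply/ler_addgt0Pl => e e0; rewrite addr0.
apply: (le_trans (close (e / (N + N' + 1)) _)); first by rewrite divr_gt0 // ltr_wpDl.
rewrite mulrCA; apply: ler_piMr; first exact: ltW.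
by rewrite ler_pdivrMr ?mul1r ?lerDl ?ler01 // ltr_wpDl.
Qed.

Lemma mean_prod_independent (d : measure_display) (T : measurableType d)
    (R : realType) (P : probability T R) (I : finType) (X : I -> {RV P >-> R})
    (h : I -> R -> R) :
  mutually_independent X -> (forall i, bounded_measurable (h i)) ->
  mean P (fun w => \prod_i h i (X i w)) = \prod_i mean P (fun w => h i (X i w)).
Proof.
move=> indX.
have mX i : measurable_fun setT (X i) by exact: measurable_funPT.
suff main (s : seq I) (g : I -> R -> R) : (forall i, bounded_measurable (g i)) ->
    (forall i, i \notin s -> exists2 A, measurable A & g i = \1_A) ->
    mean P (fun w => \prod_i g i (X i w)) = \prod_i mean P (fun w => g i (X i w)).
  by move=> bh; apply: (main (enum I)) => // i; rewrite mem_enum.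
elim: s g => [|k s IH] g bg gs.
  have /fin_all_exists2 [A mA gA] : forall i, exists2 A, measurable A & g i = \1_A.
    by move=> i; apply: gs.
  have gE i w : g i (X i w) = \1_(X i @^-1` A i) w by rewrite gA !indicE.
  have mXA i : measurable (X i @^-1` A i).
    by rewrite -[X in measurable X]setTI; exact: mX.
  have mcap : measurable (\bigcap_(k in [set` [set: I]%SET]) (X k @^-1` A k)).
    by apply: fin_bigcap_measurable => // k _.
  have -> : mean P (fun w => \prod_i g i (X i w)) =
      fine (P (\bigcap_(k in [set` [set: I]%SET]) (X k @^-1` A k))).
    rewrite -mean_indic //; apply: eq_Rintegral => w _.
    under eq_bigr do rewrite gE.
    have [wA|wA] := boolP (w \in _).
      apply: big1 => i _; rewrite indicE mem_set //.
      by move: wA; rewrite inE; apply; rewrite /= inE.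
    have [i wi] : exists i, ~ (X i @^-1` A i) w.
      apply/existsNP => wall; move/negP: wA; apply; rewrite inE => i _; exact: wall.
    by rewrite (bigD1 i) //= indicE memNset ?mul0r.
  rewrite indX //.
  rewrite [X in fine X](eq_bigl xpredT); last by move=> i; rewrite finset.in_setT.
  have PE i : P (X i @^-1` A i) = (mean P (fun w => g i (X i w)))%:E.
    have -> : mean P (fun w => g i (X i w)) = fine (P (X i @^-1` A i)).
      by rewrite -mean_indic //; apply: eq_Rintegral => w _; rewrite gE.
    by rewrite fineK // fin_num_measure.
  by under eq_bigr do rewrite PE; rewrite prodEFin.
pose Y w := \prod_(i | i != k) g i (X i w).
pose c := \prod_(i | i != k) mean P (fun w => g i (X i w)).
have bgX i : bounded_measurable (fun w => g i (X i w)).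
  exact: bounded_measurable_comp.
have bY : bounded_measurable Y by exact: bounded_measurable_prod.
(* Testing [X k] against the random weight [Y], the product of the other factors, is compared with
   testing it against the constant [c]; for indicators the two agree by induction. *)
have key := @mean_comp_eq _ _ _ P (X k) (X k) Y (fun=> c) (mX k) (mX k) bY
  (bounded_measurable_cst T c) _ (g k) (bg k).
transitivity (mean P (fun w => Y w * g k (X k w))).
  by apply: eq_Rintegral => w _; rewrite (bigD1 k) //= mulrC.
rewrite key; last first.
  move=> A mA; pose g' i := if i == k then \1_A else g i.
  have := IH g' _ _; rewrite (bigD1 k) //= /g' eqxx.
  rewrite (eq_bigr (fun i => mean P (fun w => g i (X i w)))); last by move=> i /negPf ->.
  rewrite -/c => E; rewrite meanZ; last first.
    by apply: (bounded_measurable_comp _ (mX k)); exact: bounded_measurable_indic.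
  rewrite mulrC -E.
  - apply: eq_Rintegral => w _; rewrite [RHS](bigD1 k) //= eqxx mulrC; congr (_ * _).
    by apply: eq_bigr => i /negPf ->.
  - by move=> i; case: ifP => // _; exact: bounded_measurable_indic.
  - move=> i is_; case: ifP => [_|ik]; first by exists A.
    by apply: gs; rewrite inE ik.
by rewrite meanZ // [RHS](bigD1 k) //= mulrC.
Qed.

Lemma markov_mean (d : measure_display) (T : measurableType d) (R : realType)
    (P : probability T R) (Z : T -> R) (a : R) : 0 < a ->
  bounded_measurable Z -> (forall w, 0 <= Z w) ->
  (P [set w | a < Z w]%R <= (mean P Z / a)%:E)%E.
Proof.
move=> a0 bZ Z0; have [mZ _] := bZ.
have mA : measurable [set w | a < Z w].
  have -> : [set w | a < Z w] = Z @^-1` `]a, +oo[%classic.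
    by apply/seteqP; split => w; rewrite /= in_itv /= andbT.
  by rewrite -[X in measurable X]setTI; apply: mZ; rewrite //; exact: measurable_itv.
rewrite -[X in (X <= _)%E]fineK ?fin_num_measure // -mean_indic // lee_fin.
rewrite ler_pdivlMr // mulrC -meanZ; last exact: bounded_measurable_indic.
apply: mean_le => //; first by apply: bounded_measurableZ; exact: bounded_measurable_indic.
move=> w; rewrite indicE; have [|_] := boolP (w \in _); last by rewrite mulr0.
by rewrite inE mulr1 => /ltW.
Qed.

(** Values beyond the level are dropped to 0, not clipped. The function is odd, which keeps a
    symmetric law centred. *)
Definition truncate (R : realType) (B x : R) : R := if `|x| <= B then x else 0.

Lemma truncate_norm_le (R : realType) (B x : R) : 0 <= B -> `|truncate B x| <= B.
Proof. by move=> B0; rewrite /truncate; case: ifP => // _; rewrite normr0. Qed.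

Lemma bounded_measurable_truncate (R : realType) (B : R) : 0 <= B ->
  bounded_measurable (truncate B).
Proof.
move=> B0; split; last by exists B => x; exact: truncate_norm_le.
apply: measurable_fun_ifT => //; apply: measurable_fun_ler => //.
Qed.

(** If [X] is almost surely bounded by [B], truncation changes it only on a null set; if [X] is
    symmetric, oddness makes the mean equal to its own negative. *)
Lemma mean_truncate_eq0 (d : measure_display) (T : measurableType d)
    (R : realType) (P : probability T R) (X : {RV P >-> R}) (B : R) : 0 <= B ->
  ('E_P[X] = 0)%E ->
  {ae P, forall w, `|X w| <= B} \/ symmetric_distribution X ->
  mean P (fun w => truncate B (X w)) = 0.
Proof.
move=> B0 EX; have mX : measurable_fun setT X by exact: measurable_funPT.
have bB := bounded_measurable_truncate B0.
have bX := bounded_measurable_comp bB mX.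
case=> [aeX|symX].
  rewrite /Rintegral; move: EX; rewrite unlock => EX.
  rewrite (ae_eq_integral (fun w => (X w)%:E)) ?EX //.
  - by apply/measurable_EFinP; case: bX.
  - exact/measurable_EFinP.
  - by apply: filterS aeX => w XB _; rewrite /truncate XB.
have mNX : measurable_fun setT (fun w => - X w) by exact: measurable_funN.
have b1 := bounded_measurable_cst T (1 : R).
(* The constant weight 1 lets [mean_comp_eq] extend the symmetry from sets to bounded functions. *)
have E : mean P (fun w => 1 * truncate B (- X w)) =
         mean P (fun w => 1 * truncate B (X w)).
  apply: mean_comp_eq => // A mA.
  have eqA Y : measurable_fun setT Y ->
      mean P (fun w => 1 * \1_A (Y w)) = fine (P [set w | A (Y w)]).
    move=> mY; have mYA : measurable [set w | A (Y w)].
      by rewrite -[X in measurable X]setTI; exact: mY.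
    rewrite -mean_indic //; apply: eq_Rintegral => w _; rewrite mul1r !indicE.
    by congr (_%:R); congr nat_of_bool; apply/idP/idP; rewrite !inE.
  by rewrite !eqA // symX.
have N : mean P (fun w => truncate B (- X w)) = - mean P (fun w => truncate B (X w)).
  rewrite -mulN1r -meanZ //; apply: eq_Rintegral => w _.
  by rewrite /truncate normrN mulN1r; case: ifP => // _; rewrite oppr0.
have E' : mean P (fun w => truncate B (- X w)) = mean P (fun w => truncate B (X w)).
  transitivity (mean P (fun w => 1 * truncate B (- X w))).
    by apply: eq_Rintegral => w _; rewrite mul1r.
  by rewrite E; apply: eq_Rintegral => w _; rewrite mul1r.
by move: N; rewrite E' => N; lra.
Qed.

(** All but two of the factors are bounded by [B], and the truncated square is at most [X^2], whose
    mean is the variance because [X] is centred. *)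
Lemma mean_truncate_expr (d : measure_display) (T : measurableType d)
    (R : realType) (P : probability T R) (X : {RV P >-> R}) (B sigma : R) (k : nat) :
  0 <= B -> ('E_P[X] = 0)%E -> (variance P X <= (sigma ^+ 2)%:E)%E ->
  `|mean P (fun w => truncate B (X w) ^+ k.+2)| <= sigma ^+ 2 * B ^+ k.
Proof.
move=> B0 EX VX; have mX : measurable_fun setT X by exact: measurable_funPT.
have bX := bounded_measurable_comp (bounded_measurable_truncate B0) mX.
have bX2 := bounded_measurable_expr 2 bX.
have sq : mean P (fun w => truncate B (X w) ^+ 2) <= sigma ^+ 2.
  rewrite -lee_fin /Rintegral fineK; last first.
    exact: integrable_fin_num (bounded_measurable_integrable P bX2).
  apply: le_trans VX; rewrite /variance covariance.unlock EX expectation.unlock /=.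
  apply: ge0_le_integral => //.
  - by move=> w _; rewrite lee_fin sqr_ge0.
  - by apply/measurable_EFinP; case: bX2.
  - apply/measurable_EFinP; apply: measurable_funM; apply: measurable_funB => //;
      exact: measurable_cst.
  - move=> w _; rewrite lee_fin -[leRHS]/((X w - 0) * (X w - 0)) subr0 -expr2 /truncate.
    by case: ifP => // _; rewrite expr0n sqr_ge0.
have bXk := bounded_measurable_expr k.+2 bX.
have bound w : `|truncate B (X w) ^+ k.+2| <= B ^+ k * truncate B (X w) ^+ 2.
  rewrite -[in leRHS]real_normK ?num_real // normrX -addn2 exprD ler_wpM2r ?exprn_ge0 //.
  by rewrite lerXn2r ?nnegrE // truncate_norm_le.
have up : mean P (fun w => B ^+ k * truncate B (X w) ^+ 2) <= sigma ^+ 2 * B ^+ k.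
  by rewrite meanZ // mulrC ler_wpM2r ?exprn_ge0.
rewrite ler_norml; apply/andP; split.
  rewrite lerNl -mulN1r -meanZ //; apply: le_trans up; apply: mean_le => //.
  - exact: bounded_measurableZ.
  - exact: bounded_measurableZ.
  - by move=> w; rewrite mulN1r (le_trans _ (bound w)) // -normrN ler_norm.
apply: le_trans up; apply: mean_le => //; first exact: bounded_measurableZ.
by move=> w; apply: le_trans (bound w); exact: ler_norm.
Qed.

Lemma bounded_measurable_controlled (d : measure_display) (T : measurableType d)
    (R : realType) (E : finType) (n N p : nat) (K : R) (Z : (E -> R) -> R)
    (x : T -> E -> R) : controlled n N p K Z ->
  (forall e, bounded_measurable (fun w => x w e)) ->
  bounded_measurable (fun w => Z (x w)).
Proof.
move=> [W [ZW _ _]] bx.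
under [X in bounded_measurable X]eq_fun do rewrite ZW.
apply: bounded_measurable_sum => w; apply: bounded_measurableZ.
exact: bounded_measurable_prod.
Qed.

(** Independence factors the mean of each monomial over its edges; [prod_moments_le] then bounds it
    by [nu^p] times its weight from the empty history, and these weights sum to at most [K]. *)
Lemma mean_controlled_le (d : measure_display) (T : measurableType d)
    (R : realType) (P : probability T R) (E : finType) (n N p : nat)
    (X : E -> {RV P >-> R}) (sigma B nu K : R) (Z : (E -> R) -> R) :
  (0 < n)%N -> (0 < N)%N -> (p <= N)%N -> 0 <= sigma -> 0 <= B ->
  sigma * Num.sqrt (n * N)%:R <= nu -> B * N%:R <= nu ->
  mutually_independent X ->
  (forall e, mean P (fun w => truncate B (X e w)) = 0) ->
  (forall e k, `|mean P (fun w => truncate B (X e w) ^+ k.+2)| <=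
     sigma ^+ 2 * B ^+ k) ->
  controlled n N p K Z ->
  mean P (fun w => Z (fun e => truncate B (X e w))) <= nu ^+ p * K.
Proof.
move=> n0 N0 pN s0 B0 snu Bnu indX m1 m2 [W [ZW sW bW]].
have nu0 : 0 <= nu by apply: le_trans Bnu; rewrite mulr_ge0.
have bB := bounded_measurable_truncate B0.
have mX e : measurable_fun setT (X e) by exact: measurable_funPT.
have bX e := bounded_measurable_comp bB (mX e).
have bprod (es : seq E) : bounded_measurable (fun w => \prod_(e <- es) truncate B (X e w)).
  exact: bounded_measurable_prod.
have prodE (es : seq E) : `|mean P (fun w => \prod_(e <- es) truncate B (X e w))| <=
    nu ^+ size es * seq_weight R n N [::] es.
  have -> : mean P (fun w => \prod_(e <- es) truncate B (X e w)) =
      \prod_e mean P (fun w => truncate B (X e w) ^+ count_mem e es).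
    rewrite -(mean_prod_independent (h := fun e x => truncate B x ^+ count_mem e es)) //.
      by apply: eq_Rintegral => w _; rewrite prod_seq_count.
    by move=> e; exact: bounded_measurable_expr.
  apply: (prod_moments_le (m := fun e k => mean P (fun w => truncate B (X e w) ^+ k))
     (sigma := sigma) (B := B)) => // e.
  by rewrite -[RHS](mean_cst P); exact: eq_Rintegral.
have -> : mean P (fun w => Z (fun e => truncate B (X e w))) =
    \sum_(v <- W) v.1 * mean P (fun w => \prod_(e <- v.2) truncate B (X e w)).
  under [RHS]eq_bigr do rewrite -meanZ //.
  rewrite -mean_sum; last by move=> v; exact: bounded_measurableZ.
  by apply: eq_Rintegral => w _; rewrite ZW.
apply: (@le_trans _ _ (\sum_(v <- W) nu ^+ p * (`|v.1| * seq_weight R n N [::] v.2))).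
  rewrite big_seq [leRHS]big_seq; apply: ler_sum => v vW.
  rewrite (le_trans (ler_norm _)) // normrM mulrCA ler_wpM2l //.
  by rewrite -(sW _ vW).
by rewrite -mulr_sumr ler_wpM2l ?exprn_ge0 // bW.
Qed.

(** * The good event *)

Lemma holds_of_bad_event (d : measure_display) (T : measurableType d)
    (R : realType) (P : probability T R) (a : R) (N A : set T) :
  measurable N -> (P N <= a%:E)%E -> (forall w, ~ N w -> A w) ->
  holds_with_probability_at_least P (1 - a) A.
Proof.
move=> mN Na NA; exists (~` N); split => //; first exact: measurableC.
by rewrite probability_setC // EFinB leeB.
Qed.

Lemma bad_event_of_holds (d : measure_display) (T : measurableType d)
    (R : realType) (P : probability T R) (a : R) (A : set T) :
  holds_with_probability_at_least P (1 - a) A ->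
  exists N, [/\ measurable N, (P N <= a%:E)%E & forall w, ~ N w -> A w].
Proof.
move=> [E [mE EA PE]]; exists (~` E); split; first exact: measurableC.
  rewrite probability_setC //; move: PE.
  rewrite -[P E]fineK ?fin_num_measure // -EFinB !lee_fin; lra.
by move=> w /notP/EA.
Qed.

Lemma holds_mono (d : measure_display) (T : measurableType d) (R : realType)
    (P : probability T R) (p q : R) (A B : set T) : q <= p -> A `<=` B ->
  holds_with_probability_at_least P p A -> holds_with_probability_at_least P q B.
Proof.
move=> qp AB [E [mE EA PE]]; exists E; split => //; first exact: subset_trans AB.
by apply: le_trans PE; rewrite lee_fin.
Qed.

Lemma holds_and (d : measure_display) (T : measurableType d) (R : realType)
    (P : probability T R) (a b : R) (A B : set T) :
  holds_with_probability_at_least P (1 - a) A ->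
  holds_with_probability_at_least P (1 - b) B ->
  holds_with_probability_at_least P (1 - (a + b)) (A `&` B).
Proof.
move=> /bad_event_of_holds [N [mN Na NA]] /bad_event_of_holds [M [mM Mb MB]].
apply: (@holds_of_bad_event _ _ _ _ _ (N `|` M)); first exact: measurableU.
  by rewrite (le_trans (measureU2 _ mN mM)) // EFinD leeD.
by move=> w /not_orP [/NA Aw /MB Bw].
Qed.

Lemma holds_forall (d : measure_display) (T : measurableType d) (R : realType)
    (P : probability T R) (I : finType) (a : R) (A : I -> set T) :
  (forall i, holds_with_probability_at_least P (1 - a) (A i)) ->
  holds_with_probability_at_least P (1 - #|I|%:R * a) [set w | forall i, A i w].
Proof.
move=> hA; have main (s : seq I) : holds_with_probability_at_least P
    (1 - (size s)%:R * a) [set w | forall i, i \in s -> A i w].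
  elim: s => [|i s IH].
    rewrite mul0r; apply: (@holds_of_bad_event _ _ _ _ _ set0) => //.
    by rewrite measure0.
  apply: holds_mono (holds_and (hA i) IH); first by rewrite /= -natr1; lra.
  move=> w [Ai As] j.
  by rewrite inE => /orP[/eqP ->|/As].
rewrite cardE; apply: holds_mono (main (enum I)) => // w Aw i.
by apply: Aw; rewrite mem_enum.
Qed.

(* Markov's inequality for Z^r, whose mean is at most (nu^q K)^r; since r q is
   of order log n, a constant factor per step gains a power of n. *)
Lemma controlled_tail (d : measure_display) (T : measurableType d)
    (R : realType) (P : probability T R) (E : finType) (n L q r : nat)
    (X : E -> {RV P >-> R}) (sigma B nu K : R) (Z : (E -> R) -> R) :
  (0 < n)%N -> (0 < L)%N -> (n <= 2 ^ L)%N ->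
  (0 < r)%N -> ~~ odd r -> (2 * L <= r * q <= 4 * L)%N ->
  0 <= sigma -> 0 < B -> 0 < K ->
  sigma * Num.sqrt (n * (4 * L))%:R <= nu -> B * (4 * L)%:R <= nu ->
  mutually_independent X ->
  (forall e, mean P (fun w => truncate B (X e w)) = 0) ->
  (forall e k, `|mean P (fun w => truncate B (X e w) ^+ k.+2)| <=
     sigma ^+ 2 * B ^+ k) ->
  controlled n (4 * L) q K Z ->
  holds_with_probability_at_least P (1 - n%:R ^- 12)
    [set w | `|Z (fun e => truncate B (X e w))| <= (64 * nu) ^+ q * K].
Proof.
move=> n0 L0 nL r0 re /andP[rq1 rq2] s0 B0 K0 snu Bnu indX m1 m2 cZ.
have nu0 : 0 < nu.
  by apply: lt_le_trans Bnu; rewrite mulr_gt0 // ltr0n muln_gt0.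
have cZr := controlled_expr r (ltW K0) cZ.
set x := fun w e => truncate B (X e w).
have bx e : bounded_measurable (fun w => x w e).
  apply: bounded_measurable_comp; last exact: measurable_funPT.
  by apply: bounded_measurable_truncate; exact: ltW.
have bZ := bounded_measurable_controlled cZr bx.
have Zge0 w : 0 <= Z (x w) ^+ r by exact: exprn_even_ge0.
have EZ : mean P (fun w => Z (x w) ^+ r) <= nu ^+ (r * q) * K ^+ r.
  apply: (mean_controlled_le n0 _ rq2 s0 (ltW B0) snu Bnu indX m1 m2 cZr).
  by rewrite muln_gt0.
pose a := ((64 * nu) ^+ q * K) ^+ r.
have a0 : 0 < a by rewrite !(exprn_gt0, mulr_gt0).
have aE : a = 64 ^+ (r * q) * (nu ^+ (r * q) * K ^+ r).
  by rewrite /a !exprMn -!exprM mulnC mulrA.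
have [mZ _] := bZ.
apply: (@holds_of_bad_event _ _ _ _ _ [set w | a < Z (x w) ^+ r]).
- have -> : [set w | a < Z (x w) ^+ r] = (fun w => Z (x w) ^+ r) @^-1` `]a, +oo[%classic.
    by apply/seteqP; split => w; rewrite /= in_itv /= andbT.
  by rewrite -[X in measurable X]setTI; apply: mZ; rewrite //; exact: measurable_itv.
- apply: le_trans (markov_mean P a0 bZ Zge0) _; rewrite lee_fin.
  rewrite ler_pdivrMr //; apply: le_trans EZ _.
  rewrite aE [leRHS]mulrA; apply: ler_peMl; first by rewrite mulr_ge0 ?exprn_ge0 ?ltW.
  rewrite mulrC ler_pdivlMr ?exprn_gt0 ?ltr0n // mul1r.
  (* Since [64 = 2^6] and [r q >= 2 L], the gain [64^(r q)] is at least [2^(12 L) >= n^12]. *)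
  rewrite -!natrX ler_nat; apply: leq_trans (leq_pexp2l _ rq1) => //.
  apply: (@leq_trans ((2 ^ L) ^ 12)%N); first by rewrite leq_exp2r.
  by rewrite -[64%N]/(2 ^ 6)%N -!expnM leq_exp2l //; lia.
move=> w /= /negP; rewrite -leNgt => Za.
have c0 : 0 <= (64 * nu) ^+ q * K by rewrite !(mulr_ge0, exprn_ge0) ?ltW.
rewrite -(ler_pXn2r r0) ?nnegrE //.
by rewrite -normrX (ger0_norm (Zge0 w)).
Qed.

(** For [n >= 2] the rounded-up binary logarithm is at most twice the exact one, as [L - 1] and 1
    are both at most [log2 n]. *)
Lemma log_budget (R : realType) (n : nat) : (1 < n)%N ->
  (4 * up_log 2 n)%:R <= 8 / ln 2 * ln n%:R :> R.
Proof.
move=> n1; have l2 : 0 < ln 2 :> R by rewrite ln_gt0 // ltr1n.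
have ln_n : ln 2 <= ln n%:R :> R by rewrite ler_ln ?posrE ?ltr0n ?ler_nat // ltnW.
have : (up_log 2 n).-1%:R * ln 2 <= ln n%:R :> R.
  rewrite mulr_natl -lnXn ?ltr0n // -natrX ler_ln ?posrE ?ltr0n ?expn_gt0 ?(ltnW n1) //.
  by rewrite ler_nat ltnW // up_log_gtn.
have : (0 < up_log 2 n)%N by rewrite up_log_gt0.
case: (up_log 2 n) => // l _ /= hl.
rewrite natrM -natr1 mulrAC ler_pdivlMr //; nra.
Qed.

Lemma ln2_le1 (R : realType) : ln 2 <= 1 :> R.
Proof. by rewrite (le_trans (le_ln1Dx _)) // (natrD _ 1 1) addrK. Qed.

(** The step budget [4 L] is at most [q ln n] with [q = 8 / ln 2]; under the square root this costs
    only [sqrt q], which is at most [q] because [q >= 1]. *)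
Lemma moment_scale_le (R : realType) (n : nat) (sigma B : R) : (1 < n)%N ->
  0 <= sigma -> 0 < B ->
  Num.max (sigma * Num.sqrt (n * (4 * up_log 2 n))%:R) (B * (4 * up_log 2 n)%:R)
  <= 8 / ln 2 * noise_level n sigma B.
Proof.
move=> n1 s0 B0; have l2 : 0 < ln 2 :> R by rewrite ln_gt0 // ltr1n.
have := log_budget R n1; set L := (4 * _)%N; set q := 8 / ln 2 => Lq.
have q1 : 1 <= q by rewrite /q ler_pdivlMr // mul1r (le_trans (ln2_le1 R)) // ler1n.
have ln0 : 0 <= ln n%:R :> R by rewrite ln_ge0 // ler1n ltnW.
rewrite ge_max /noise_level; apply/andP; split.
  apply: (@le_trans _ _ (q * (sigma * Num.sqrt (n%:R * ln n%:R)))); last first.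
    by rewrite ler_wpM2l ?le_max ?lexx // (le_trans ler01).
  rewrite mulrCA ler_wpM2l //.
  have -> : q * Num.sqrt (n%:R * ln n%:R) = Num.sqrt (q ^+ 2 * (n%:R * ln n%:R)).
    by rewrite [RHS]sqrtrM ?sqr_ge0 // sqrtr_sqr ger0_norm // (le_trans ler01).
  apply: ler_wsqrtr; rewrite natrM mulrCA ler_wpM2l //.
  apply: (le_trans Lq); rewrite expr2 -[leRHS]mulrA; apply: ler_peMl => //.
  by rewrite mulr_ge0 // (le_trans ler01).
apply: (@le_trans _ _ (q * (B * ln n%:R))); last first.
  by rewrite ler_wpM2l ?le_max ?lexx ?orbT // (le_trans ler01).
by rewrite mulrCA ler_wpM2l // ltW.
Qed.

Lemma truncation_agrees (d : measure_display) (T : measurableType d)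
    (R : realType) (P : probability T R) (X : {RV P >-> R}) (B eps : R) :
  0 <= eps ->
  {ae P, forall w, `|X w| <= B} \/
    (symmetric_distribution X /\ (P [set w | (B < `|X w|)%R] <= eps%:E)%E) ->
  holds_with_probability_at_least P (1 - eps) [set w | `|X w| <= B].
Proof.
move=> e0 aX; have mX : measurable_fun setT X by exact: measurable_funPT.
have mA : measurable [set w | B < `|X w|].
  have -> : [set w | B < `|X w|] = (fun w => `|X w|) @^-1` `]B, +oo[%classic.
    by apply/seteqP; split => w; rewrite /= in_itv /= andbT.
  have mnX : measurable_fun setT (fun w => `|X w|) by exact: measurableT_comp.
  by rewrite -[X in measurable X]setTI; apply: mnX; rewrite //; exact: measurable_itv.
apply: (holds_of_bad_event mA); last by move=> w /negP; rewrite -leNgt.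
case: aX => [aeX|[] //].
rewrite measure_negligible ?lee_fin //.
apply: negligibleS aeX => w /= Bw wB; move: Bw; by rewrite ltNge wB.
Qed.

(** A union bound over [n^2] truncations, [L n] walks and [n^2] Gram entries, each failing with
    probability of order [n^-12]. The tail constant 64 times 2 per step gives 128, and passing to
    the operator norm doubles it to 256. *)
Lemma noise_good_event (d : measure_display) (T : measurableType d)
    (R : realType) (P : probability T R) (n : nat) (cb sigma B nu kappa : R)
    (H : 'I_n -> 'I_n -> {RV P >-> R}) (v : 'cV[R]_n) :
  let L := up_log 2 n in
  (1 < n)%N -> 0 < cb -> 0 <= sigma -> 0 < B -> noise_assumption cb sigma B H ->
  sigma * Num.sqrt (n * (4 * L))%:R <= nu -> B * (4 * L)%:R <= nu ->
  0 < kappa -> (forall k, `|v k 0| <= kappa) ->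
  holds_with_probability_at_least P (1 - (cb + 3) * n%:R ^- 9)
    [set w | (forall x : 'cV[R]_n, norm2 (toC (random_matrix H w *m x)) <=
                256 * nu * norm2 (toC x)) /\
             (forall s k, (s <= L)%N -> `|iter s (mulmx (random_matrix H w)) v k 0| <=
                (128 * nu) ^+ s * kappa)].
Proof.
move=> L n1 cb0 s0 B0 [indH EH VH aH] snu Bnu k0 vk.
have n0 : (0 < n)%N by exact: ltnW.
have L0 : (0 < L)%N by rewrite up_log_gt0.
have nL : (n <= 2 ^ L)%N by exact: up_logP.
have Ln : (L < n.*2)%N.
  apply: (@leq_ltn_trans n); last by rewrite -addnn -[ltnLHS]addn0 ltn_add2l.
  by apply: up_log_min => //; rewrite ltnW // ltn_expl.
have nu0 : 0 <= nu by apply: le_trans Bnu; rewrite mulr_ge0 // ltW.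
pose X (e : 'I_n * 'I_n) := H e.1 e.2.
have m1 e : mean P (fun w => truncate B (X e w)) = 0.
  apply: mean_truncate_eq0 (ltW B0) (EH _ _) _.
  by case: (aH e.1 e.2) => [?|[? _]]; [left|right].
have m2 e k : `|mean P (fun w => truncate B (X e w) ^+ k.+2)| <= sigma ^+ 2 * B ^+ k.
  exact: mean_truncate_expr (ltW B0) (EH _ _) (VH _ _).
pose Ht w := entries_mx (fun e => truncate B (X e w)).
have tail := controlled_tail n0 L0 nL _ _ _ s0 B0 _ snu Bnu indH m1 m2.
have agree : holds_with_probability_at_least P (1 - #|{: 'I_n * 'I_n}|%:R * (cb * n%:R ^- 12))
    [set w | forall e, `|X e w| <= B].
  apply: holds_forall => e; apply: truncation_agrees; last exact: aH.
  by rewrite mulr_ge0 ?invr_ge0 ?exprn_ge0 // ltW.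
have walks : holds_with_probability_at_least P (1 - #|{: 'I_L * 'I_n}|%:R * n%:R ^- 12)
    [set w | forall e : 'I_L * 'I_n, `|iter e.1.+1 (mulmx (Ht w)) v e.2 0| <=
       (64 * nu) ^+ e.1.+1 * (2 ^+ e.1.+1 * kappa)].
  apply: holds_forall => -[s i] /=.
  (* The moment is the even number that brings the total length [r (s + 1)] between [2 L] and [4 L];
     the upper bound uses [s + 1 <= L]. *)
  have := tail s.+1 (2 * (L %/ s.+1).+1)%N _ _ _ _ _ _ (controlled_walk _ _ i vk).
  apply => //; first by rewrite oddM.
    have sL := ltn_ord s; have := divn_eq L s.+1; have := ltn_mod L s.+1.
    by move: (L %/ _)%N (L %% _)%N => a b; nia.
  by rewrite mulr_gt0 ?exprn_gt0.
have gram : holds_with_probability_at_least P (1 - #|{: 'I_n * 'I_n}|%:R * n%:R ^- 12)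
    [set w | forall e : 'I_n * 'I_n,
       `|iter L (fun x => (Ht w)^T *m (Ht w *m x)) (delta_mx e.2 0 : 'cV_n) e.1 0| <=
       (64 * nu) ^+ L.*2 * (2 ^+ L.*2 * 1)].
  apply: holds_forall => -[i j] /=.
  (* Gram walks already have length [2 L], so the second moment suffices. *)
  have := tail L.*2 2%N _ _ _ _ _ _ (controlled_gram_walk _ _ i _).
  apply => //.
  - by rewrite -mul2n; lia.
  - by move=> k; rewrite mxE; case: (_ && _); rewrite ?normr1 ?normr0.
apply: holds_mono (holds_and agree (holds_and walks gram)).
  rewrite lerD2l lerN2 !card_prod !card_ord.
  have nR : 0 < n%:R :> R by rewrite ltr0n.
  have -> : (n * n)%:R * (cb * n%:R ^- 12) + ((L * n)%:R * n%:R ^- 12 + (n * n)%:R * n%:R ^- 12)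
     = (cb * n%:R ^+ 2 + (L%:R * n%:R + n%:R ^+ 2)) * n%:R ^- 12 :> R.
    by rewrite !natrM; ring.
  have -> : n%:R ^- 9 = n%:R ^+ 3 * n%:R ^- 12 :> R.
    by field; rewrite pnatr_eq0 -lt0n.
  rewrite [leRHS]mulrA ler_wpM2r ?invr_ge0 ?exprn_ge0 //.
  have LR : L%:R <= 2 * n%:R :> R by rewrite -natrM ler_nat mul2n ltnW.
  have n1R : 1 <= n%:R :> R by rewrite ler1n.
  have h1 : L%:R * n%:R <= 2 * n%:R * n%:R :> R by rewrite ler_wpM2r.
  have h2 : n%:R ^+ 2 * 1 <= n%:R ^+ 2 * n%:R :> R by rewrite ler_wpM2l ?sqr_ge0.
  have h3 : cb * (n%:R ^+ 2 * 1) <= cb * (n%:R ^+ 2 * n%:R) by rewrite ler_wpM2l // ltW.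
  by rewrite !exprS expr0 in h1 h2 h3 *; lra.
move=> w [/= agr [wlk grm]].
have HE : random_matrix H w = Ht w.
  by apply/matrixP => i j; rewrite !mxE /truncate; have := agr (i, j); rewrite /X /= => ->.
rewrite HE; split.
  move=> x; have -> : 256 * nu = 2 * (128 * nu) by ring.
  apply: (norm2_mulmx_gram (L := L)); rewrite ?mulr_ge0 // => i j.
  apply: le_trans (grm (i, j)) _; rewrite mulr1 -exprMn.
  by have -> : 64 * nu * 2 = 128 * nu by ring.
case=> [|s] k sL; first by rewrite /= mul1r.
apply: le_trans (wlk (Ordinal sL, k)) _; rewrite mulrA -exprMn.
by have -> : 64 * nu * 2 = 128 * nu by ring.
Qed.

(** * Rescaling and choice of constants *)

(** A nonzero real factor multiplies all eigenvalues, preserving the order of their moduli and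
    whether they are real; this reduces the problem to [lambda = 1]. *)
Lemma is_leading_eigenvector_scale (R : realType) (n : nat) (c : R) (M : 'M[R]_n)
    (u : 'cV[R[i]]_n) : c != 0 ->
  is_leading_eigenvector (c *: M) u -> is_leading_eigenvector M u.
Proof.
move=> c0 [l [[le lmax] lu u1 ureal]].
have cC0 : c%:C != 0 by rewrite fmorph_eq0.
have toCM : toC (c *: M) = c%:C *: toC M by rewrite /toC map_mxZ.
have eigZ z : eigenvalue (toC (c *: M)) (c%:C * z) = eigenvalue (toC M) z.
  apply/eigenvalueP/eigenvalueP => -[v vM v0]; exists v => //.
    by apply: (scalerI cC0); rewrite scalemxAr -toCM vM scalerA.
  by rewrite toCM -scalemxAr vM scalerA.
have lE : l = c%:C * (c%:C^-1 * l) by rewrite mulVKf.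
exists (c%:C^-1 * l); split.
- split; first by rewrite -eigZ -lE.
  move=> z; rewrite -eigZ => /lmax; rewrite {1}lE !normrM.
  by rewrite ler_pM2l ?normr_gt0.
- by apply: (scalerI cC0); rewrite scalemxAl -toCM lu scalerA -lE.
- exact: u1.
- move=> lr; apply: ureal; rewrite lE rpredM //.
  by apply/complex_realP; exists c.
Qed.

Lemma iter_mulmx_scale (R : realType) (n s : nat) (c : R) (H : 'M[R]_n)
    (v : 'cV[R]_n) : iter s (mulmx (c *: H)) v = c ^+ s *: iter s (mulmx H) v.
Proof.
elim: s => [|s IH]; first by rewrite scale1r.
by rewrite !iterS IH -scalemxAl -scalemxAr scalerA -exprS.
Qed.

Theorem corollary3 (R : realType) (cb : R) (hcb : 0 < cb) :
  exists c1 C C' : R, [/\ 0 < c1, 0 < C, 0 < C' &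
    forall (n : nat) (lambda : R) (ustar : 'cV[R]_n) (mu sigma B : R)
      (d : measure_display) (T : measurableType d) (P : probability T R)
      (H : 'I_n -> 'I_n -> {RV P >-> R}) (u : T -> 'cV[R[i]]_n),
    lambda != 0 ->
    norm2 (toC ustar) = 1 ->
    is_incoherence ustar mu ->
    0 <= sigma -> 0 < B ->
    noise_assumption cb sigma B H ->
    noise_level n sigma B <= c1 * `|lambda| ->
    (forall w : T,
       is_leading_eigenvector
         (lambda *: (ustar *m ustar^T) + random_matrix H w) (u w)) ->
    holds_with_probability_at_least P (1 - C' * n%:R ^- 9)
      [set w : T |
        Num.min (norm_inf (u w - toC ustar)) (norm_inf (u w + toC ustar))
        <= C * (noise_level n sigma B / `|lambda|) * Num.sqrt (mu / n%:R)]].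
Proof.
have [q q0 moment_le] : exists2 q : R, 0 < q &
    forall (n : nat) (sigma B : R), (1 < n)%N -> 0 <= sigma -> 0 < B ->
    Num.max (sigma * Num.sqrt (n * (4 * up_log 2 n))%:R)
      (B * (4 * up_log 2 n)%:R) <= q * noise_level n sigma B.
  exists (8 / ln 2); last by move=> n sigma B; exact: moment_scale_le.
  by rewrite divr_gt0 ?ltr0n // ln_gt0 // ltr1n.
(* [4096 = 256 * 16] makes the scaled operator norm at most 1/16, and [3072 = 12 * 256] combines the
   perturbation constant with the operator-norm constant. *)
exists (4096 * q)^-1, (3072 * q), (cb + 3); split.
- by rewrite invr_gt0; apply: mulr_gt0 q0; rewrite ltr0n.
- by apply: mulr_gt0 q0; rewrite ltr0n.
- by apply: addr_gt0 hcb _; rewrite ltr0n.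
move=> n lambda us mu sigma B d T P H u l0 us1 [mu0 us_inf _] s0 B0 noise small lead.
have [n1|n1] := leqP n 1.
  have n_eq1 : n = 1%N.
    apply/eqP; rewrite eqn_leq n1 lt0n; apply/eqP => n_eq0; subst n.
    by move: us1; rewrite /norm2 big_ord0 sqrtr0 => /eqP; rewrite eq_sym oner_eq0.
  (* For [n = 1] the claimed probability [1 - (cb + 3)] is negative, so the empty event suffices. *)
  exists set0; split => //; rewrite measure0 lee_fin n_eq1.
  by rewrite expr1n invr1 mulr1; lra.
set kappa := Num.sqrt (mu / n%:R) in us_inf *.
have us_le k : `|us k 0| <= kappa.
  apply: le_trans us_inf; rewrite -normc_real.
  have -> : (us k 0)%:C = toC us k 0 by rewrite mxE.
  exact: le_bigmax.
have nR : 1 < n%:R :> R by rewrite ltr1n.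
have kappa0 : 0 <= kappa by exact: sqrtr_ge0.
(* A unit vector has sup norm at least [n^(-1/2)]; the weaker bound [1/n] is what [2^-L <= 1/n] is
   compared with. *)
have kappa_ge : n%:R^-1 <= kappa.
  have : 1 <= n%:R * kappa ^+ 2.
    rewrite -[leLHS](expr1n _ 2) -{1}us1 norm2_real_sqr.
    rewrite mulr_natl -[X in _ *+ X]card_ord -sumr_const.
    apply: ler_sum => k _; rewrite -real_normK ?num_real //.
    by rewrite lerXn2r ?nnegrE.
  move=> h; rewrite leNgt; apply/negP; rewrite -div1r ltr_pdivlMr; last by lra.
  by move=> h1; nra.
have kappa_gt0 : 0 < kappa by apply: lt_le_trans kappa_ge; rewrite invr_gt0; lra.
set L := up_log 2 n.
pose nu := Num.max (sigma * Num.sqrt (n * (4 * L))%:R) (B * (4 * L)%:R).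
have snu : sigma * Num.sqrt (n * (4 * L))%:R <= nu by rewrite le_max lexx.
have Bnu : B * (4 * L)%:R <= nu by rewrite le_max lexx orbT.
have nu0 : 0 <= nu by apply: le_trans Bnu; rewrite mulr_ge0 // ltW.
have nu_le : nu <= q * noise_level n sigma B by exact: moment_le.
have labs : 0 < `|lambda| by rewrite normr_gt0.
pose delta := 256 * nu / `|lambda|.
have delta0 : 0 <= delta.
  exact: divr_ge0 (mulr_ge0 (ler0n R 256) nu0) (normr_ge0 lambda).
have delta_le : delta <= 256 * q * (noise_level n sigma B / `|lambda|).
  rewrite /delta mulrA; apply: ler_wpM2r; first by rewrite invr_ge0 normr_ge0.
  by rewrite -mulrA; apply: ler_wpM2l nu_le; exact: ler0n.
have delta16 : delta <= 16^-1.
  rewrite ler_pdivrMr //.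
  have := ler_wpM2l (ltW q0) small; rewrite invfM mulrA [q * (_ * _)]mulrCA mulfV ?gt_eqF //.
  by lra.
apply: holds_mono (noise_good_event n1 hcb s0 B0 noise snu Bnu kappa_gt0 us_le) => //.
move=> w /= [opH walkH].
apply: (@le_trans _ _ (12 * delta * kappa)); last first.
  by apply: (ler_wpM2r kappa0); lra.
pose Hw := random_matrix H w.
have scaled : lambda *: (us *m us^T) + Hw = lambda *: (us *m us^T + lambda^-1 *: Hw).
  by rewrite scalerDr scalerA mulfV // scale1r.
have := lead w; rewrite -/Hw scaled => /(is_leading_eigenvector_scale l0).
apply: (leading_eigenvector_perturbation (L := L) us1).
- by rewrite delta0.
- move=> x; rewrite -scalemxAl /toC map_mxZ norm2Z normc_real normfV.
  rewrite ler_pdivrMl //; apply: le_trans (opH x) _.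
  by rewrite /delta mulrA [`|lambda| * _]mulrC divfK ?gt_eqF.
- move=> s k sL; rewrite iter_mulmx_scale mxE normrM normrX normfV.
  have -> : delta ^+ s * kappa = `|lambda|^-1 ^+ s * ((256 * nu) ^+ s * kappa).
    by rewrite /delta exprMn mulrCA mulrA.
  rewrite ler_wpM2l ?exprn_ge0 ?invr_ge0 //; apply: le_trans (walkH s k sL) _.
  (* The walk constant 128 is relaxed to 256 so that a single [delta] serves both bounds. *)
  apply: (ler_wpM2r kappa0); apply: lerXn2r; rewrite ?nnegrE.
  + exact: mulr_ge0 (ler0n R 128) nu0.
  + exact: mulr_ge0 (ler0n R 256) nu0.
  + by apply: (ler_wpM2r nu0); rewrite ler_nat.
- apply: le_trans kappa_ge; rewrite exprVn lef_pV2 ?posrE ?exprn_gt0 //; last by lra.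
  by rewrite -natrX ler_nat up_logP.
Qed.
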